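(* Neither the tropical Grassmannian $\operatorname{TGr}(3,\mathbb{Q}^6)$ nor the Naruki fan is a good parametrizing set for moneric classes of 3-dimensional subspaces of $\Bbbk^6$, where $\Bbbk=\mathbb{Q}(t)$. Explicitly, with the terminology and the maps $\Phi_{\mathrm{Gr}}$, $\Phi_{\mathrm{Nar}}$ defined in the context: (1) there exist admissible 3-dimensional subspaces $G,G'\subset\Bbbk^6$ with $\Phi_{\mathrm{Gr}}(G)=\Phi_{\mathrm{Gr}}(G')$ such that $G$ is moneric and $G'$ is not moneric; (2) there exist admissible 3-dimensional subspaces $G,G'\subset\Bbbk^6$ with $\Phi_{\mathrm{Nar}}(G)=\Phi_{\mathrm{Nar}}(G')$ such that $G$ is moneric and $G'$ is not moneric.
   Context: Let $\Bbbk=\mathbb{Q}(t)$ with the valuation $\operatorname{val}:\Bbbk^\times\to\mathbb{Z}$ where $\operatorname{val}(p)$ is the unique integer $\omega$ such that $t^{-\omega}p(t)$ is defined and nonzero at $t=0$; the residue field is $\mathbb{Q}$. For a nonzero polynomial $f$ with coefficients in $\Bbbk$, let $\omega_0$ be the minimum of the valuations of its nonzero coefficients; its initial form is $\operatorname{in}(f)=(t^{-\omega_0}f)|_{t=0}$, a polynomial over $\mathbb{Q}$. A set of nonzero polynomials is moneric if $\operatorname{in}(f)$ is a monomial (up to a nonzero scalar coefficient) for every $f$ in it. Admissible subspaces. Let $A=(a_{ij})$ be a $3\times 6$ matrix over $\Bbbk$ with columns $a^{(1)},\dots,a^{(6)}$ and maximal minors (Plücker coordinates) $p_{ijk}$,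 $1\le i<j<k\le 6$. Put $C=p_{134}p_{156}p_{235}p_{246}-p_{135}p_{146}p_{234}p_{256}$. Assume all $p_{ijk}\ne 0$ and $C\neq 0$ (equivalently, the six points $a^{(i)}\in\mathbb{P}^2$ are such that no three lie on a line and not all six lie on a conic). The 3-dimensional subspace $G=\ker A\subset\Bbbk^6$ is then called admissible. The subspace $G$ determines $A$ up to left multiplication by $\operatorname{GL}_3(\Bbbk)$, hence determines $(p_{ijk})$ up to a common nonzero scalar. Generators of the Cox ring. In $\Bbbk[x_1,\dots,x_6,y_1,\dots,y_6]$ put $l_i=\sum_{j=1}^6 a_{ij}\,y_j\prod_{k\ne j}x_k$ for $i=1,2,3$. The blow-up $X_G$ of $\mathbb{P}^2$ at the six points $a^{(i)}$ is a del Pezzo surface of degree 3. Its Cox ring is identified with the ring of invariants $\Bbbk[x_1,\dots,x_6,y_1,\dots,y_6]^G$ for Nagata's action of $G$ ($x_i\mapsto x_i$, $y_i\mapsto y_i+\lambda_ix_i$ for $\lambda\in G$), and it has the following minimal generating set of 27 polynomials, determined up to nonzero scalars by $G$: the variables $x_1,\dots,x_6$; for each $1\le i<j\le6$, the polynomial $g_{ij}(l_1,l_2,l_3)\,x_i^{-1}x_j^{-1}$, where $g_{ij}\in \Bbbk[z_1,z_2,z_3]$ is the linear form defining the line through $a^{(i)}$ and $a^{(j)}$; for each $1\le m\le 6$, the polynomial $q_m(l_1,l_2,l_3)\prod_{j\neq m}x_j^{-1}$, where $q_m\in\Bbbk[z_1,z_2,z_3]$ is the quadratic form defining the unique conic through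 the five points $a^{(j)}$, $j\ne m$. An admissible subspace $G$ is called moneric if this set of 27 polynomials is moneric. Maps to the candidate parametrizing sets. The tropical Grassmannian $\operatorname{TGr}(3,\mathbb{Q}^6)\subset\mathbb{R}^{20}$ is the tropicalization of the locus where all Plücker coordinates are nonzero in the affine cone over the Plücker-embedded Grassmannian $\operatorname{Gr}(3,\mathbb{Q}^6)$. The map $\Phi_{\mathrm{Gr}}$ sends $G$ to the point $(-\operatorname{val}(p_{ijk}))_{i<j<k}$, considered modulo adding multiples of $(1,\dots,1)$ (which accounts for the scaling of the Plücker vector). The Naruki fan is a fan structure on the tropicalization, inside $\mathbb{R}^{15}$, of the moduli space $Y^6$ of marked degree 3 del Pezzo surfaces, a very affine variety with coordinates given by the $p_{ijk}$ and $C$ up to the action of the torus $\mathbb{G}_m^6$ rescaling the columns of $A$. The map $\Phi_{\mathrm{Nar}}$ sends $G$ to the class of $\big((-\operatorname{val}(p_{ijk}))_{i<j<k},\,-\operatorname{val}(C)\big)\in\mathbb{R}^{21}$ in the quotient $\mathbb{R}^{15}$ of $\mathbb{R}^{21}$ by the 6-dimensional subspace $\{((\mu_i+\mu_j+\mu_k)_{i<j<k},\,2\sum_i\mu_i) : \mu\in\mathbb{R}^6\}$. Good parametrizing set. A set $M$ with a map from subspaces to $M$ is a good parametrizing set for moneric subspaces if for any two subspaces $G,G'$ mapped to the same point of $M$, $G$ moneric implies $G'$ moneric. *)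

(* Defs.v *)
From HB Require Import structures.
From mathcomp Require Import all_boot all_order all_algebra.
From mathcomp Require Import mpoly.
From mathcomp Require Import reals.

Set Implicit Arguments.
Unset Strict Implicit.
Unset Printing Implicit Defensive.

Import Order.TTheory GRing.Theory Num.Theory.
Local Open Scope ring_scope.

Local Notation "x %:F" := (tofrac x).

Definition K : fieldType := {fraction {poly rat}}.
Definition t : K := 'X%:F.

(* Numerator and denominator in lowest terms: the representative [repr f]
   chosen by the quotient construction need not be reduced. *)
Definition num (f : K) : {poly rat} :=
  \n_(repr f) %/ gcdp \n_(repr f) \d_(repr f).
Definition den (f : K) : {poly rat} :=
  \d_(repr f) %/ gcdp \n_(repr f) \d_(repr f).

Definition defined_at0 (f : K) : bool := (den f).[0] != 0.

(* Value at t = 0; meaningful only when [defined_at0 f]. *)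
Definition at0 (f : K) : rat := (num f).[0] / (den f).[0].

(* Order of vanishing at t = 0; meaningful only for f != 0.
   See [val_spec] for the characterization by t^(-w) f. *)
Definition val (f : K) : int := (mup 0 (num f))%:Z - (mup 0 (den f))%:Z.

Lemma num_den (f : K) :
  [/\ den f != 0, coprimep (num f) (den f) & f = (num f)%:F / (den f)%:F].
Proof.
rewrite /num /den; set n := \n_(repr f); set d := \d_(repr f).
have d0 : d != 0 by exact: denom_ratioP.
have g0 : gcdp n d != 0 by rewrite gcdp_eq0 negb_and d0 orbT.
have dE : d = d %/ gcdp n d * gcdp n d by rewrite divpK // dvdp_gcdr.
have nE : n = n %/ gcdp n d * gcdp n d by rewrite divpK // dvdp_gcdl.
have fE : f = n%:F / d%:F.
  have dF : (d%:F : K) != 0 by rewrite tofrac_eq0.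
  apply: (canRL (mulfK dF)); rewrite -[LHS]/(FracField.mul _ _).
  unlock FracField.mul FracField.tofrac; apply/eqmodP => /=.
  rewrite FracField.equivfE /FracField.mulf.
  have := FracField.equivf_l (Ratio d 1).
  rewrite !numden_Ratio ?mulf_neq0 ?oner_neq0 ?denom_ratioP // !mulr1 => ->.
  by rewrite -/n -/d mulrCA [n * d]mulrC mulrA [d * _]mulrC.
split.
- by apply: contraNneq d0 => E; rewrite dE E mul0r.
- by apply: coprimep_div_gcd; rewrite d0 orbT.
rewrite {1}fE {1}dE {1}nE !tofracM -mulf_div divff ?mulr1 //.
by rewrite tofrac_eq0.
Qed.

Lemma val_frac (n d : {poly rat}) : n != 0 -> d != 0 ->
  val (n%:F / d%:F) = (mup 0 n)%:Z - (mup 0 d)%:Z.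
Proof.
move=> n0 d0.
have nF : (n%:F : K) != 0 by rewrite tofrac_eq0.
have dF : (d%:F : K) != 0 by rewrite tofrac_eq0.
have : (n%:F / d%:F : K) != 0 := mulf_neq0 nF (invr_neq0 dF).
move E0 : (n%:F / d%:F : K) => f f0; rewrite /val.
have [df0 _ fE] := num_den f.
have dfF : ((den f)%:F : K) != 0 by rewrite tofrac_eq0.
have nf0 : num f != 0.
  by apply: contraNneq f0 => E; rewrite fE E tofrac0 mul0r.
have : (num f * d)%:F = (n * den f)%:F :> K.
  by rewrite !tofracM; apply/eqP; rewrite -(eqr_div _ _ dfF dF) -fE E0.
move/eqP; rewrite tofrac_eq => /eqP /(congr1 (mup 0)).
rewrite !mupM // => E; apply/eqP; rewrite subr_eq addrAC eq_sym subr_eq eq_sym.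
by rewrite -!PoszD E.
Qed.

Lemma val_spec (f : K) (w : int) : f != 0 ->
  (defined_at0 (t ^ (- w) * f) && (at0 (t ^ (- w) * f) != 0)) = (w == val f).
Proof.
move=> f0.
have t0 : t != 0 by rewrite /t tofrac_eq0 polyX_eq0.
have : t ^ (- w) * f != 0 := mulf_neq0 (expfz_neq0 _ t0) f0.
move hdef : (t ^ (- w) * f) => h h0.
have [dh0 cop hE] := num_den h.
have nh0 : num h != 0.
  by apply: contraNneq h0 => E; rewrite hE E tofrac0 mul0r.
have [df0 _ fE] := num_den f.
have nf0 : num f != 0.
  by apply: contraNneq f0 => E; rewrite fE E tofrac0 mul0r.
have mX k : mup 0 ('X^k : {poly rat}) = k.
  by have := mup_XsubCX k (0 : rat) 0; rewrite eqxx polyC0 subr0.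
have X0 k : ('X^k : {poly rat}) != 0 by rewrite expf_neq0 // polyX_eq0.
have valh : val h = val f - w.
  rewrite -hdef {1}fE /t {2}/val; case: w {h h0 dh0 cop hE nh0 hdef} => k.
    have -> : 'X%:F ^ (- k%:Z) * ((num f)%:F / (den f)%:F)
              = (num f)%:F / ('X^k * den f)%:F :> K.
      by rewrite -exprnN -tofracXn tofracM invfM mulrCA.
    by rewrite val_frac ?mulf_neq0 // mupM // mX PoszD opprD addrA addrAC.
  have -> : 'X%:F ^ (- Negz k) * ((num f)%:F / (den f)%:F)
            = ('X^(k.+1) * num f)%:F / (den f)%:F :> K.
    by rewrite NegzE opprK -exprnP -tofracXn mulrA -tofracM.
  by rewrite val_frac ?mulf_neq0 // mupM // mX PoszD NegzE opprK -addrA addrC.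
have mu0 p : p != 0 -> (p.[0] != 0) = (mup (0 : rat) p == 0%N).
  move=> p0; rewrite -[_ == 0](rootE p 0) -leqn0 mup_leq // expr1.
  by rewrite dvdp_XsubCl.
rewrite [w == _]eq_sym -[val f == w]subr_eq0 -valh /defined_at0 /at0.
rewrite mulf_eq0 invr_eq0 negb_or andbCA andbb !mu0 // /val subr_eq0 eqz_nat.
have [E|ne] := eqVneq (mup 0 (num h)) 0%N; first by rewrite E eq_sym.
have nr : root (num h) 0 by rewrite rootE -[_ == 0]negbK mu0.
have /eqP -> : mup 0 (den h) == 0%N by rewrite -mu0 //; exact: coprimep_root cop nr.
by rewrite (negbTE ne).
Qed.

(* t ^ (- w0) f at t = 0, where w0 is the least valuation of a coefficient;
   meaningful for f != 0. *)
Definition min_val n (f : {mpoly K[n]}) : int :=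
  \big[Order.min/val (mleadc f)]_(m <- msupp f) val f@_m.

Definition initial_form n (f : {mpoly K[n]}) : {mpoly rat[n]} :=
  \sum_(m <- msupp f) at0 (t ^ (- min_val f) * f@_m) *: 'X_[m].

Definition moneric_poly n (f : {mpoly K[n]}) : Prop :=
  exists m : 'X_{1..n}, exists2 c : rat, c != 0 & initial_form f = c *: 'X_[m].

Definition ker_space (A : 'M[K]_(3, 6)) : {vspace 'cV[K]_6} :=
  lker (linfun (mulmx A : 'cV[K]_6 -> 'cV[K]_3)).

(* The index set of the Plücker coordinates. *)
Definition triple : finType :=
  {s : 3.-tuple 'I_6 | sorted ltn (map (@nat_of_ord 6) s)}.

Definition plucker (A : 'M[K]_(3, 6)) (s : 3.-tuple 'I_6) : K :=
  \det (colsub (tnth s) A).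

(* Plücker coordinates with columns labelled 1, ..., 6. *)
Definition p1 (A : 'M[K]_(3, 6)) (i j k : nat) : K :=
  plucker A [tuple inZp i.-1; inZp j.-1; inZp k.-1].

Definition conic_cond (A : 'M[K]_(3, 6)) : K :=
  p1 A 1 3 4 * p1 A 1 5 6 * p1 A 2 3 5 * p1 A 2 4 6
  - p1 A 1 3 5 * p1 A 1 4 6 * p1 A 2 3 4 * p1 A 2 5 6.

Definition admissible (G : {vspace 'cV[K]_6}) : Prop :=
  \dim G = 3%N /\
  exists A : 'M[K]_(3, 6),
    [/\ ker_space A = G, forall s : triple, plucker A (\val s) != 0
      & conic_cond A != 0].

(* The ring K[x_1, ..., x_6, y_1, ..., y_6]. *)
Definition xvar (i : 'I_6) : {mpoly K[6 + 6]} := 'X_(lshift 6 i).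
Definition yvar (i : 'I_6) : {mpoly K[6 + 6]} := 'X_(rshift 6 i).

Definition lpoly (A : 'M[K]_(3, 6)) : 3.-tuple {mpoly K[6 + 6]} :=
  [tuple \sum_(j < 6) A i j *: (yvar j * \prod_(k < 6 | k != j) xvar k) | i < 3].

Definition vanishes_at (A : 'M[K]_(3, 6)) (g : {mpoly K[3]}) (i : 'I_6) : Prop :=
  g.@[fun r => A r i] = 0.

(* The 27 generators, each with all of its nonzero scalar multiples. The
   divisions by monomials in the x_k are written multiplicatively. *)
Inductive cox_generator (A : 'M[K]_(3, 6)) : {mpoly K[6 + 6]} -> Prop :=
| CoxVar (i : 'I_6) (c : K) :
    c != 0 -> cox_generator A (c *: xvar i)
| CoxLine (i j : 'I_6) (g : {mpoly K[3]}) (f : {mpoly K[6 + 6]}) :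
    (i < j)%N ->
    g != 0 -> g \is 1.-homog ->
    vanishes_at A g i -> vanishes_at A g j ->
    f * xvar i * xvar j = g \mPo lpoly A ->
    cox_generator A f
| CoxConic (m : 'I_6) (q : {mpoly K[3]}) (f : {mpoly K[6 + 6]}) :
    q != 0 -> q \is 2.-homog ->
    (forall j : 'I_6, j != m -> vanishes_at A q j) ->
    f * \prod_(j < 6 | j != m) xvar j = q \mPo lpoly A ->
    cox_generator A f.

(* For admissible G, a matrix with kernel G is unique up to GL_3, and the set of generators does
   not depend on its choice. *)
Definition moneric (G : {vspace 'cV[K]_6}) : Prop :=
  forall (A : 'M[K]_(3, 6)) (f : {mpoly K[6 + 6]}),
    ker_space A = G -> cox_generator A f -> moneric_poly f.

(* A point of the quotient V / L is represented by the coset v + L. *)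
Definition coset (V : zmodType) (L : V -> Prop) (v : V) : V -> Prop :=
  fun w => L (w - v).

Definition trop_plucker (R : realType) (A : 'M[K]_(3, 6)) : {ffun triple -> R} :=
  [ffun s : triple => - (val (plucker A (\val s)))%:~R].

Definition lin_Gr (R : realType) (u : {ffun triple -> R}) : Prop :=
  exists c : R, u = [ffun => c].

(* The coset does not depend on the matrix A with kernel G. *)
Definition Phi_Gr (R : realType) (G : {vspace 'cV[K]_6}) :
    {ffun triple -> R} -> Prop :=
  fun w => exists2 A : 'M[K]_(3, 6),
    ker_space A = G & coset (@lin_Gr R) (trop_plucker R A) w.

Definition trop_plucker_conic (R : realType) (A : 'M[K]_(3, 6)) :
    ({ffun triple -> R} * R)%type :=
  (trop_plucker R A, - (val (conic_cond A))%:~R).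

Definition lin_Nar (R : realType) (u : ({ffun triple -> R} * R)%type) : Prop :=
  exists mu : 'I_6 -> R,
    u = ([ffun s : triple => \sum_(r < 3) mu (tnth (\val s) r)],
         2 * \sum_(i < 6) mu i).

Definition Phi_Nar (R : realType) (G : {vspace 'cV[K]_6}) :
    ({ffun triple -> R} * R)%type -> Prop :=
  fun w => exists2 A : 'M[K]_(3, 6),
    ker_space A = G & coset (@lin_Nar R) (trop_plucker_conic R A) w.

(* Only the fibres of Phi matter, so M may be taken to be any set containing
   the image of Phi. *)
Definition good_parametrizing (M : Type) (Phi : {vspace 'cV[K]_6} -> M) : Prop :=
  forall G G' : {vspace 'cV[K]_6}, admissible G -> admissible G' ->
    Phi G = Phi G' -> moneric G -> moneric G'.

(* Main.v *)
Require Import Defs.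
From mathcomp Require Import all_boot all_order all_algebra.
From mathcomp Require Import mpoly.
From mathcomp Require Import reals ring.
From mathcomp Require boolp.

Set Implicit Arguments.
Unset Strict Implicit.
Unset Printing Implicit Defensive.

Import Order.TTheory GRing.Theory Num.Theory.
Local Open Scope ring_scope.

Local Notation "x %:F" := (tofrac x).
(* The valuation, and not the projection of a subtype. *)
Local Notation val := Defs.val.

(** A single pair of subspaces [G], [G'] proves both parts: the two matrices have
    Plücker coordinates of the same valuations, and conic conditions [C] of the
    same valuation, so that [G] and [G'] have the same image under both maps,
    but [G] is moneric and [G'] is not.

    Multiplying a generator by a monomial does not change whether its initial
    form is a monomial, so the generators may be replaced by the polynomials
    [g(l_1, l_2, l_3)], whose monomials are products of the
    [Y_j = y_j \prod_(k != j) x_k] ([moneric_poly_mulX]). For the line through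
    the points [i], [j] the coefficients are the Plücker coordinates [p_ijk], and
    their valuations are determined by the two maps ([line_values]). For the
    conic through the points [j != m], written as a sum over ordered pairs
    [(u, v)], the coefficient of [Y_u Y_v] is, up to a common scalar, the value at
    the points [u], [v] of the polar form of the conic ([conic_values]). Up to
    this scalar, it is a product of brackets when [u], [v], [m] are distinct, zero
    when [u = v != m], and a multiple of [C] when [u = v = m]. But for [u != v = m]
    it is the value at the point [m] of the tangent line at [u]; this is a sum of
    two products of brackets, in which cancellation is possible. For [m = 6], in
    the normalization of [polar], the coefficient of [Y_3 Y_6] is of order 20 for
    [G], lower than all others, while for [G'] it is zero, and the lowest order 21
    is shared by [Y_1 Y_3] and [Y_6^2].

    A matrix with kernel [G] is determined up to left multiplication by an
    invertible matrix, which multiplies all brackets by its determinant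
    ([bracket_ker]). Hence only the brackets of one matrix are needed, and those
    are polynomials in [t] with integer coefficients, which are computed as lists
    of coefficients. *)

(** * Valuations and values at t = 0 *)

Lemma num_den_eq (n d : {poly rat}) : d != 0 ->
  num (n%:F / d%:F) * d = n * den (n%:F / d%:F).
Proof.
move=> d0; set f : K := _ / _; have [df0 _ fE] := num_den f.
have dF : (d%:F : K) != 0 by rewrite tofrac_eq0.
have dfF : ((den f)%:F : K) != 0 by rewrite tofrac_eq0.
apply/eqP; rewrite -tofrac_eq !tofracM -(eqr_div _ _ dfF dF) -fE.
by [].
Qed.

Lemma defined_at0_frac (n d : {poly rat}) : d.[0] != 0 ->
  defined_at0 (n%:F / d%:F).
Proof.
move=> d0; have dn0 : d != 0 by apply: contraNneq d0 => ->; rewrite horner0.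
have E := num_den_eq n dn0; have [_ cop _] := num_den (n%:F / d%:F).
rewrite /defined_at0; apply: contraNneq d0 => dE0.
have : root (num (n%:F / d%:F) * d) 0.
  by rewrite E rootE hornerM dE0 mulr0.
rewrite rootM rootE => /orP[/eqP nE0|/eqP->//].
have : root (den (n%:F / d%:F)) 0 by rewrite rootE dE0.
rewrite coprimep_sym in cop.
by move/(coprimep_root cop); rewrite nE0 eqxx.
Qed.

Lemma at0_frac (n d : {poly rat}) : d.[0] != 0 ->
  at0 (n%:F / d%:F) = n.[0] / d.[0].
Proof.
move=> d0; have dn0 : d != 0 by apply: contraNneq d0 => ->; rewrite horner0.
have := congr1 (horner^~ 0) (num_den_eq n dn0); rewrite !hornerM => E.
have := defined_at0_frac n d0; rewrite /defined_at0 /at0 => df0.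
by apply/eqP; rewrite eqr_div // E.
Qed.

Lemma at0_mulF (u : K) (r : {poly rat}) : defined_at0 u ->
  at0 (u * r%:F) = at0 u * r.[0].
Proof.
move=> du; have [_ _ uE] := num_den u.
by rewrite {1}uE mulrAC -tofracM at0_frac // hornerM /at0 mulrAC.
Qed.

Lemma at00 : at0 0 = 0.
Proof.
have := @at0_frac 0 1; rewrite hornerC tofrac0 mul0r => ->.
  by rewrite horner0 mul0r.
by rewrite oner_eq0.
Qed.

Lemma t_neq0 : t != 0.
Proof. by rewrite /t tofrac_eq0 polyX_eq0. Qed.

Lemma val_mul (f g : K) : f != 0 -> g != 0 -> val (f * g) = val f + val g.
Proof.
move=> f0 g0; have [df _ fE] := num_den f; have [dg _ gE] := num_den g.
have nf : num f != 0 by apply: contraNneq f0 => E; rewrite fE E tofrac0 mul0r.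
have ng : num g != 0 by apply: contraNneq g0 => E; rewrite gE E tofrac0 mul0r.
rewrite {1}fE {1}gE mulf_div -!tofracM val_frac ?mulf_neq0 // !mupM //.
by rewrite /val !PoszD opprD addrACA.
Qed.

Lemma valF (p : {poly rat}) : p != 0 -> val (p%:F) = (mup 0 p)%:Z.
Proof.
move=> p0; have := @val_frac p 1 p0 (oner_neq0 _).
by rewrite tofrac1 divr1 (@mupNroot _ 0 1) ?root1 // subr0.
Qed.

Lemma val_exp (f : K) n : f != 0 -> val (f ^+ n) = val f *+ n.
Proof.
move=> f0; elim: n => [|n IH]; last first.
  by rewrite exprS val_mul ?expf_neq0 // IH mulrS.
by rewrite expr0 -tofrac1 valF ?oner_neq0 // mupNroot // root1.
Qed.

Lemma mup_XnM d (r : {poly rat}) : r != 0 -> mup 0 ('X^d * r) = (d + mup 0 r)%N.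
Proof.
move=> r0; rewrite mupM ?expf_neq0 ?polyX_eq0 //.
by have := mup_XsubCX d (0 : rat) 0; rewrite eqxx polyC0 subr0 => ->.
Qed.

Lemma mup_eq0 (r : {poly rat}) : r.[0] != 0 -> mup 0 r = 0%N.
Proof. by move=> r0; rewrite mupNroot. Qed.

Lemma val_scaled (c : K) d (r : {poly rat}) : c != 0 -> r != 0 ->
  val (c * ('X^d * r)%:F) = val c + (d + mup 0 r)%:Z.
Proof.
move=> c0 r0; have Xr : 'X^d * r != 0.
  by rewrite mulf_neq0 // expf_neq0 ?polyX_eq0.
by rewrite val_mul ?tofrac_eq0 // valF // mup_XnM.
Qed.

(** * Initial forms *)

Section InitialForm.
Variable n : nat.
Implicit Types (f : {mpoly K[n]}) (m e : 'X_{1..n}).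

(** The bound [min_val f] on the valuations of the coefficients is attained. *)
Lemma min_valP f : f != 0 ->
  (forall m, f@_m != 0 -> min_val f <= val f@_m) /\
  (exists2 m, f@_m != 0 & val f@_m = min_val f).
Proof.
move=> f0; rewrite /min_val; split=> [m|].
  rewrite -mcoeff_msupp; elim: (msupp f) => //= m' s IH.
  rewrite inE big_cons ge_min => /predU1P[->|/IH ->]; first by rewrite lexx.
  by rewrite orbT.
have s_sub : {subset msupp f <= msupp f} by [].

elim: {1 3}(msupp f) s_sub => [_|m' s IH s_sub].
  rewrite big_nil; exists (mlead f) => //.
  by rewrite -/(mleadc f) mleadc_eq0.
rewrite big_cons minEle; case: ifP => _.
  by exists m' => //; rewrite -mcoeff_msupp s_sub // mem_head.
by apply: IH => x xs; rewrite s_sub // inE xs orbT.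
Qed.

Lemma min_val_unique f (w : int) :
  (forall m, f@_m != 0 -> w <= val f@_m) ->
  (exists2 m, f@_m != 0 & val f@_m = w) -> min_val f = w.
Proof.
move=> lb [m fm vm]; have f0 : f != 0.
  by apply: contraNneq fm => ->; rewrite mcoeff0.
have [lb' [m' fm' vm']] := min_valP f0.
by apply/eqP; rewrite eq_le -{1}vm lb' // -vm' lb.
Qed.

Lemma mcoeff_initial_form f m :
  (initial_form f)@_m = at0 (t ^ (- min_val f) * f@_m).
Proof.
rewrite /initial_form raddf_sum /=.
under eq_bigr do rewrite mcoeffZ mcoeffX mulr_natr mulrb.
rewrite -big_mkcond /=; have [mf|] := boolP (m \in msupp f).
  by rewrite -big_filter filter_pred1_uniq ?msupp_uniq // big_seq1.
move=> mf; rewrite memN_msupp_eq0 // mulr0 at00 big1_seq // => m'.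
by case/andP => /eqP -> mf'; rewrite mf' in mf.
Qed.

(** If every coefficient of [f] is [c t^d] times a polynomial in [t], and the
    reduction of [c^-1 t^-d f] at [t = 0] is nonzero, then the initial form is
    this reduction up to a nonzero scalar. *)
Lemma initial_form_lead f (c : K) d (r : 'X_{1..n} -> {poly rat}) m0 :
  c != 0 -> (forall m, f@_m = c * ('X^d * r m)%:F) -> (r m0).[0] != 0 ->
  exists2 s : rat, s != 0 & forall m, (initial_form f)@_m = s * (r m).[0].
Proof.
move=> c0 fE r0.
have r_neq0 m : f@_m != 0 -> r m != 0.
  by apply: contraNneq => rm; rewrite fE rm mulr0 tofrac0 mulr0.
have rm0 : r m0 != 0 by apply: contraNneq r0 => ->; rewrite horner0.
have mE : min_val f = val c + d%:Z.
  apply: min_val_unique => [m fm|].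
    by rewrite fE val_scaled ?r_neq0 // lerD2l lez_nat leq_addr.
  exists m0; last by rewrite fE val_scaled // mup_eq0 // addn0.
  have Xr : 'X^d * r m0 != 0 by rewrite mulf_neq0 // expf_neq0 ?polyX_eq0.
  by rewrite fE mulf_neq0 ?tofrac_eq0.
have := val_spec (val c) c0; rewrite eqxx => /andP[dc ac].
exists (at0 (t ^ (- val c) * c)) => // m; rewrite mcoeff_initial_form mE fE.
rewrite -at0_mulF //; congr at0.
have -> : ('X^d * r m)%:F = t ^ d%:Z * (r m)%:F by rewrite tofracM tofracXn.
rewrite opprD expfzDr ?t_neq0 // mulrACA [t ^ (- d%:Z) * _]mulrA.
by rewrite -expfzDr ?t_neq0 // addNr expr0z mul1r.
Qed.

Lemma initial_form_mulX f e : initial_form (f * 'X_[e]) = initial_form f * 'X_[e].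
Proof.
have [->|f0] := eqVneq f 0.
  by rewrite mul0r /initial_form msupp0 big_nil mul0r.
have X0 m : ~~ (e <= m)%MM -> forall R (g : {mpoly R[n]}), (g * 'X_[e])@_m = 0.
  move=> em R g; apply: memN_msupp_eq0; rewrite (perm_mem (msuppMX g e)).
  by apply: contra em => /mapP[m' _ ->]; rewrite lem_addr.
have mE : min_val (f * 'X_[e]) = min_val f.
  have [lb [m1 fm1 vm1]] := min_valP f0.
  apply: min_val_unique => [m|]; last first.
    by exists (e + m1)%MM; rewrite mcoeffMX.
  have [/submK <-|/X0 ->] := boolP (e <= m)%MM; last by rewrite eqxx.
  by rewrite addmC mcoeffMX; apply: lb.
apply/mpolyP => m; rewrite mcoeff_initial_form mE.
have [/submK <-|em] := boolP (e <= m)%MM; last by rewrite !X0 // mulr0 at00.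
by rewrite addmC !mcoeffMX mcoeff_initial_form.
Qed.

Lemma moneric_poly_mulX f e : moneric_poly (f * 'X_[e]) <-> moneric_poly f.
Proof.
rewrite /moneric_poly initial_form_mulX; split=> -[m [c c0 E]]; last first.
  by exists (m + e)%MM, c => //; rewrite E mpolyXD scalerAl.
have [em|em] := boolP (e <= m)%MM.
  exists (m - e)%MM, c => //; apply/mpolyP => m'.
  have /(congr1 (mcoeff (e + m')%MM)) := E; rewrite mcoeffMX => ->.
  by rewrite !mcoeffZ !mcoeffX -{1}(submK em) addmC eqm_add2l.
have : m \in msupp (initial_form f * 'X_[e]).
  by rewrite E mcoeff_msupp mcoeffZ mcoeffX eqxx mulr1.
rewrite (perm_mem (msuppMX _ e)) => /mapP[m' _ mE].
by rewrite mE lem_addr in em.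
Qed.

(** The two criteria for a sum of monomials [mu i], where several [i] may have
    the same monomial. *)
Section Sum.
Variables (I : finType) (mu : I -> 'X_{1..n}) (r : I -> {poly rat}).
Variables (c : K) (d : nat).
Hypothesis c0 : c != 0.
Let f : {mpoly K[n]} := \sum_i (c * ('X^d * r i)%:F) *: 'X_[mu i].
Let lead (m : 'X_{1..n}) : rat := \sum_(i | mu i == m) (r i).[0].

Lemma initial_form_sum m0 : lead m0 != 0 ->
  exists2 s : rat, s != 0 & forall m, (initial_form f)@_m = s * lead m.
Proof.
move=> lm0; pose rr m := \sum_(i | mu i == m) r i.
have rE m : (rr m).[0] = lead m by rewrite /rr horner_sum.
have fE m : f@_m = c * ('X^d * rr m)%:F.
  rewrite /f raddf_sum /= /rr mulr_sumr rmorph_sum mulr_sumr [RHS]big_mkcond.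
  by apply: eq_bigr => i _; rewrite mcoeffZ mcoeffX mulr_natr mulrb.
rewrite -rE in lm0; have [s s0 sE] := initial_form_lead c0 fE lm0.
by exists s => // m; rewrite sE rE.
Qed.

Lemma moneric_sum m0 : lead m0 != 0 ->
  (forall i, mu i != m0 -> (r i).[0] = 0) -> moneric_poly f.
Proof.
move=> lm0 r0; have [s s0 sE] := initial_form_sum lm0.
exists m0, (s * lead m0); first by rewrite mulf_neq0.
apply/mpolyP => m; rewrite sE mcoeffZ mcoeffX.
have [<-|mm0] := eqVneq m0 m; first by rewrite mulr1.
by rewrite /lead big1 ?mulr0 // => i /eqP im; rewrite r0 // im eq_sym.
Qed.

Lemma not_moneric_sum m0 m1 : m0 != m1 -> lead m0 != 0 -> lead m1 != 0 ->
  ~ moneric_poly f.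
Proof.
move=> m01 lm0 lm1 [m [a _ fE]]; have [s s0 sE] := initial_form_sum lm0.
have all_m m' : lead m' != 0 -> m = m'.
  move=> lm'; apply/eqP; have := sE m'; rewrite fE mcoeffZ mcoeffX.
  case: eqP => // _ /esym/eqP; rewrite mulr0 mulf_eq0 (negPf s0) /=.
  by rewrite (negPf lm').
by rewrite -(all_m _ lm0) -(all_m _ lm1) eqxx in m01.
Qed.

End Sum.
End InitialForm.

(** * Brackets and the polar form of a conic through five points *)

Section Formulas.
Variables (T : Type) (add mul : T -> T -> T) (opp : T -> T) (I : Type).

(** The 3 x 3 determinant with columns [i], [j], [k] of the matrix with rows
    [x], [y], [z]; the ring operations are parameters, so that the same formula
    can be evaluated on lists of integer coefficients. *)
Definition det3 (x y z : I -> T) (i j k : I) : T :=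
  add (mul (x i) (add (mul (y j) (z k)) (opp (mul (y k) (z j)))))
 (add (mul (x j) (add (mul (y k) (z i)) (opp (mul (y i) (z k)))))
      (mul (x k) (add (mul (y i) (z j)) (opp (mul (y j) (z i)))))).

Variable br : I -> I -> I -> T.

(** One of the three terms of [polar], the others being obtained by cyclic
    permutation of [a], [b], [c]; here [alpha = [d b c] [e b c] [a d e]],
    [u_b = [a u c]] and [u_c = [a b u]]. *)
Definition polar_term (d e u v a b c : I) : T :=
  mul (mul (mul (br d b c) (br e b c)) (br a d e))
      (add (mul (br a u c) (br a b v)) (mul (br a v c) (br a b u))).

(** With [br] the bracket of points of the plane, the value at [u], [v] of the
    polar form of the quadratic form that vanishes at [a], [b], [c], [d], [e].
    In the coordinates in which [a], [b], [c] are the unit vectors this form is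
    [alpha u_b u_c + beta u_a u_c + gamma u_a u_b]. *)
Definition polar (a b c d e u v : I) : T :=
  add (polar_term d e u v a b c)
 (add (polar_term d e u v b c a) (polar_term d e u v c a b)).

(** The expression [C], which is zero when the six points lie on a conic. *)
Definition conic6 (i1 i2 i3 i4 i5 i6 : I) : T :=
  add (mul (mul (mul (br i1 i3 i4) (br i1 i5 i6)) (br i2 i3 i5)) (br i2 i4 i6))
 (opp (mul (mul (mul (br i1 i3 i5) (br i1 i4 i6)) (br i2 i3 i4)) (br i2 i5 i6))).
End Formulas.

Section Morphism.
Variables (T T' : Type) (add mul : T -> T -> T) (opp : T -> T).
Variables (add' mul' : T' -> T' -> T') (opp' : T' -> T') (phi : T -> T').
Hypotheses (phiD : {morph phi : a b / add a b >-> add' a b})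
           (phiM : {morph phi : a b / mul a b >-> mul' a b})
           (phiN : {morph phi : a / opp a >-> opp' a}).
Variables (I I' : Type) (h : I' -> I).

Lemma det3_morph x y z i j k :
  phi (det3 add mul opp x y z (h i) (h j) (h k)) =
  det3 add' mul' opp' (phi \o x \o h) (phi \o y \o h) (phi \o z \o h) i j k.
Proof. by rewrite /det3 /= !(phiD, phiM, phiN). Qed.

Variables (br : I -> I -> I -> T) (br' : I' -> I' -> I' -> T').
Hypothesis brE : forall i j k, phi (br (h i) (h j) (h k)) = br' i j k.

Lemma polar_morph a b c d e u v :
  phi (polar add mul br (h a) (h b) (h c) (h d) (h e) (h u) (h v)) =
  polar add' mul' br' a b c d e u v.
Proof. by rewrite /polar /polar_term !(phiD, phiM, brE). Qed.

Lemma conic6_morph i1 i2 i3 i4 i5 i6 :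
  phi (conic6 add mul opp br (h i1) (h i2) (h i3) (h i4) (h i5) (h i6)) =
  conic6 add' mul' opp' br' i1 i2 i3 i4 i5 i6.
Proof. by rewrite /conic6 !(phiD, phiM, phiN, brE). Qed.
End Morphism.

Local Notation r0 := (ord0 : 'I_3).
Local Notation r1 := (Ordinal (isT : (1 < 3)%N)).
Local Notation r2 := (Ordinal (isT : (2 < 3)%N)).

Lemma sum3 (V : nmodType) (F : 'I_3 -> V) : \sum_r F r = F r0 + F r1 + F r2.
Proof.
rewrite !big_ord_recl big_ord0 addr0 addrA.
by congr (_ + F _ + F _); apply: val_inj.
Qed.

Section Plane.
Variables (F : fieldType) (n : nat).
Implicit Types (A B : 'M[F]_(3, n)) (i j k : 'I_n).

(** The bracket [[i j k]] of three columns of [A]. *)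
Definition bracket A : 'I_n -> 'I_n -> 'I_n -> F :=
  det3 +%R *%R -%R (A r0) (A r1) (A r2).

(** The formula [polar] for the columns of [A]. *)
Definition bpolar A := polar +%R *%R (bracket A).

Lemma det_mx3 (M : 'M[F]_3) :
  \det M = det3 +%R *%R -%R (M r0) (M r1) (M r2) r0 r1 r2.
Proof.
have M1 (N : 'M[F]_1) : \det N = N ord0 ord0 by rewrite det_mx11.
have M2 (N : 'M[F]_2) : \det N =
    N ord0 ord0 * N (lift ord0 ord0) (lift ord0 ord0)
    - N ord0 (lift ord0 ord0) * N (lift ord0 ord0) ord0.
  rewrite (expand_det_row _ ord0) !big_ord_recl big_ord0 /cofactor !M1 !mxE /=.
  rewrite !expr0 !expr1 mul1r mulN1r addr0 mulrN.
  by congr (_ * N _ _ - _ * N _ _); apply: val_inj.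
rewrite (expand_det_row _ ord0) sum3 /cofactor !M2 !mxE /det3 /=.
have l0 : lift r0 ord0 = r1 by apply: val_inj.
have l1 : lift r0 (lift ord0 ord0) = r2 by apply: val_inj.
have l2 : lift r1 ord0 = r0 by apply: val_inj.
have l3 : lift r1 (lift ord0 ord0) = r2 by apply: val_inj.
have l4 : lift r2 ord0 = r0 by apply: val_inj.
have l5 : lift r2 (lift ord0 ord0) = r1 by apply: val_inj.
rewrite !l0 !l1 !l2 !l3 !l4 !l5 expr0 expr1 sqrrN expr1n; ring.
Qed.

Lemma bracket_det A i j k :
  bracket A i j k = \det (\matrix_(r, s) A r (tnth [tuple i; j; k] s)).
Proof. by rewrite det_mx3 /bracket /det3 !mxE !(tnth_nth i). Qed.

Lemma bracket_mul (U : 'M[F]_3) A i j k :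
  bracket (U *m A) i j k = \det U * bracket A i j k.
Proof.
rewrite !bracket_det -det_mulmx; congr (\det _).
by apply/matrixP => r s; rewrite !mxE; apply: eq_bigr => q _; rewrite !mxE.
Qed.

Variable A : 'M[F]_(3, n).
Local Notation br := (bracket A).

(** Cramer's rule for four points of the plane. *)
Lemma cramer r i j k u :
  br i j k * A r u = br u j k * A r i + br i u k * A r j + br i j u * A r k.
Proof.
rewrite /bracket /det3; case: r => [[|[|[|//]]] lt_r].
- have -> : Ordinal lt_r = r0 by apply: val_inj.
  ring.
- have -> : Ordinal lt_r = r1 by apply: val_inj.
  ring.
- have -> : Ordinal lt_r = r2 by apply: val_inj.
  ring.
Qed.

(** The matrix [A] has rank 3. *)
Lemma bracket_row_free i j k : br i j k != 0 ->
  forall p (v : 'M[F]_(p, 3)), v *m A = 0 -> v = 0.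
Proof.
rewrite bracket_det; set M := \matrix_(r, s) _ => M0 p v vA.
have uM : M \in unitmx by rewrite unitmxE unitfE.
suff vM : v *m M = 0 by rewrite -(mulmxK uM v) vM mul0mx.
apply/matrixP => r s; rewrite !mxE.
have /matrixP/(_ r (tnth [tuple i; j; k] s)) := vA; rewrite !mxE => E.
by rewrite -[RHS]E; apply: eq_bigr => q _; rewrite !mxE.
Qed.

(** A nonzero linear form vanishing at two points [i], [j] is, up to a nonzero
    scalar, [u |-> [i j u]]. *)
Lemma line_values (v : 'rV[F]_3) i j k : br i j k != 0 -> v != 0 ->
  (v *m A) 0 i = 0 -> (v *m A) 0 j = 0 ->
  exists2 c, c != 0 & forall u, (v *m A) 0 u = c * br i j u.
Proof.
move=> b0 v0 vi vj; pose c := (v *m A) 0 k / br i j k.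
have vE u : (v *m A) 0 u = c * br i j u.
  apply: (mulfI b0); rewrite /c mulrCA mulrA divfK //.
  have -> : br i j k * (v *m A) 0 u =
      br u j k * (v *m A) 0 i + br i u k * (v *m A) 0 j
      + br i j u * (v *m A) 0 k.
    rewrite !mxE !mulr_sumr -!big_split /=; apply: eq_bigr => r _.
    rewrite mulrCA cramer; ring.
  by rewrite vi vj !mulr0 !add0r mulrC.
exists c => //; apply: contraNneq v0 => c0; apply/eqP.
apply: (bracket_row_free b0); apply/rowP => u.
by rewrite vE c0 mul0r mxE.
Qed.

Section Conic.
Variable S : 'M[F]_3.
Hypotheses (two0 : (2%:R : F) != 0) (symS : S^T = S).
Let s u v : F := (A^T *m S *m A) u v.

Let s_sym u v : s u v = s v u.
Proof.
by rewrite /s -[in LHS](trmxK A) -[in LHS]symS -!trmx_mul mulmxA mxE trmxK.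
Qed.

Let s_cramer a b c u v :
  br a b c * s u v = br u b c * s a v + br a u c * s b v + br a b u * s c v.
Proof.
rewrite /s -!mulmxA.
have E w : (A^T *m (S *m A)) w v = \sum_r A r w * (S *m A) r v.
  by rewrite mxE; apply: eq_bigr => r _; rewrite mxE.
rewrite !E !mulr_sumr -!big_split; apply: eq_bigr => r _ /=.
rewrite mulrA cramer; ring.
Qed.

(** The polar form in the coordinates given by three points of the conic. *)
Let s_coords a b c u v : s a a = 0 -> s b b = 0 -> s c c = 0 ->
  br a b c ^+ 2 * s u v =
    s b c * (br a u c * br a b v + br a v c * br a b u)
  + s c a * (br b u a * br b c v + br b v a * br b c u)
  + s a b * (br c u b * br c a v + br c v b * br c a u).
Proof.
move=> aa bb cc; set D := br a b c.
have Ew w : D * s w v = br v b c * s w a + br a v c * s w b + br a b v * s w c.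
  by rewrite (s_sym w v) (s_cramer a b c) (s_sym w a) (s_sym w b) (s_sym w c).
rewrite expr2 -mulrA {2}/D (s_cramer a b c).
transitivity (br u b c * (D * s a v) + br a u c * (D * s b v)
              + br a b u * (D * s c v)); first by ring.
rewrite !Ew aa bb cc (s_sym b a) (s_sym c b) (s_sym a c).
have -> : br b u a = br a b u by rewrite /bracket /det3; ring.
have -> : br b v a = br a b v by rewrite /bracket /det3; ring.
have -> : br b c u = br u b c by rewrite /bracket /det3; ring.
have -> : br b c v = br v b c by rewrite /bracket /det3; ring.
have -> : br c u b = br u b c by rewrite /bracket /det3; ring.
have -> : br c v b = br v b c by rewrite /bracket /det3; ring.
have -> : br c a u = br a u c by rewrite /bracket /det3; ring.
have -> : br c a v = br a v c by rewrite /bracket /det3; ring.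
ring.
Qed.

(** If the quadratic form with matrix [S] vanishes at five points with these
    brackets nonzero, then its polar form is [bpolar] up to a nonzero scalar. *)
Lemma conic_values a b c d e :
  br a b c != 0 -> br c d e != 0 ->
  br d c a != 0 -> br e c a != 0 -> br d a b != 0 -> br e a b != 0 ->
  S != 0 -> s a a = 0 -> s b b = 0 -> s c c = 0 -> s d d = 0 -> s e e = 0 ->
  exists2 k, k != 0 & forall u v, s u v = k * bpolar A a b c d e u v.
Proof.
move=> D0 cde0 dca0 eca0 dab0 eab0 S0 aa bb cc dd ee.
set D := br a b c in D0.
pose ga := br d a b * br e a b * br c d e.
have ga0 : ga != 0 by rewrite !mulf_neq0.
pose q p := s b c * (br p c a * br p a b) + s c a * (br p b c * br p a b)
            + s a b * (br p b c * br p c a).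
have eqs p : s p p = 0 -> q p = 0.
  rewrite /q => pp; have := s_coords p p aa bb cc; rewrite pp mulr0.
  have -> : br a p c = br p c a by rewrite /bracket /det3; ring.
  have -> : br b p a = br p a b by rewrite /bracket /det3; ring.
  have -> : br c p b = br p b c by rewrite /bracket /det3; ring.
  have -> : br a b p = br p a b by rewrite /bracket /det3; ring.
  have -> : br b c p = br p b c by rewrite /bracket /det3; ring.
  have -> : br c a p = br p c a by rewrite /bracket /det3; ring.
  move=> E; apply: (mulfI two0); rewrite mulr0 E; ring.
have Ed := eqs d dd; have Ee := eqs e ee.
have Da : D * br a d e = br d c a * br e a b - br d a b * br e c a.
  by rewrite /D /bracket /det3; ring.
have Db : D * br b d e = br d a b * br e b c - br d b c * br e a b.
  by rewrite /D /bracket /det3; ring.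
have Dc : D * br c d e = br d b c * br e c a - br d c a * br e b c.
  by rewrite /D /bracket /det3; ring.
(* The two equations determine the coefficients up to scalar: these are the
   coordinates of a cross product, divided by [D]. *)
have Ebc : s b c * ga = s a b * (br d b c * br e b c * br a d e).
  apply: (mulfI D0).
  transitivity (s b c * (br d a b * br e a b * (D * br c d e))); first by
    rewrite /ga; ring.
  transitivity (s a b * (br d b c * br e b c * (D * br a d e))); last by ring.
  apply: subr0_eq; rewrite Da Dc.
  transitivity (br d b c * br d a b * q e - br e b c * br e a b * q d).
    by rewrite /q; ring.
  by rewrite Ed Ee !mulr0 subr0.
have Eca : s c a * ga = s a b * (br d c a * br e c a * br b d e).
  apply: (mulfI D0).
  transitivity (s c a * (br d a b * br e a b * (D * br c d e))); first by
    rewrite /ga; ring.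
  transitivity (s a b * (br d c a * br e c a * (D * br b d e))); last by ring.
  apply: subr0_eq; rewrite Db Dc.
  transitivity (br e c a * br e a b * q d - br d c a * br d a b * q e).
    by rewrite /q; ring.
  by rewrite Ed Ee !mulr0 subr0.
pose k := s a b / (ga * D ^+ 2).
have sE u v : s u v = k * bpolar A a b c d e u v.
  apply: (mulfI ga0); apply: (mulfI (expf_neq0 2 D0)).
  have -> : D ^+ 2 * (ga * (k * bpolar A a b c d e u v))
            = s a b * bpolar A a b c d e u v.
    by rewrite /k; field; rewrite ga0 D0.
  rewrite mulrCA s_coords //.
  transitivity (s b c * ga * (br a u c * br a b v + br a v c * br a b u)
     + s c a * ga * (br b u a * br b c v + br b v a * br b c u)
     + s a b * ga * (br c u b * br c a v + br c v b * br c a u)).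
    by ring.
  rewrite Ebc Eca /bpolar /polar /polar_term /ga; ring.
exists k => //; apply: contraNneq S0 => k0.
have AS : A^T *m S *m A = 0.
  by apply/matrixP => u v; rewrite -[LHS]/(s u v) sE k0 mul0r mxE.
have /(congr1 trmx) := bracket_row_free D0 AS.
rewrite trmx_mul trmxK symS trmx0 => SA.
by apply/eqP/(bracket_row_free D0 SA).
Qed.
End Conic.
End Plane.

(** * Linear and quadratic forms in the [l_i] *)

Section Generators.
Variable A : 'M[K]_(3, 6).

(** The monomial of [y_j \prod_(k != j) x_k]. *)
Definition eta (j : 'I_6) : 'X_{1..6 + 6} :=
  (U_(rshift 6 j) + \sum_(k < 6 | k != j) U_(lshift 6 k))%MM.

Lemma eta_y j i : eta j (rshift 6 i) = (j == i) :> nat.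
Proof.
rewrite /eta mnmDE mnm1E eq_rshift mnm_sumE big1 ?addn0 // => k _.
by rewrite mnm1E eq_lrshift.
Qed.

Lemma eta_x j i : eta j (lshift 6 i) = (i != j) :> nat.
Proof.
rewrite /eta mnmDE mnm1E eq_rlshift add0n mnm_sumE.
under eq_bigr do rewrite mnm1E eq_lshift.
have [->|ij] := eqVneq i j; first by rewrite big1 // => k /negPf ->.
by rewrite (bigD1 i) //= eqxx big1 // => k /andP[_ /negPf ->].
Qed.

Lemma eta_inj : injective eta.
Proof.
move=> j k /(congr1 (fun m : 'X_{1..6 + 6} => m (rshift 6 j))).
by rewrite !eta_y eqxx; case: eqP.
Qed.

(** A product of two of these monomials determines its two factors. *)
Lemma etaD_eq j k a b : (eta j + eta k == eta a + eta b)%MM =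
  ((j, k) == (a, b)) || ((j, k) == (b, a)).
Proof.
apply/eqP/orP => [E|[/eqP[-> ->]//|/eqP[-> ->]]]; last by rewrite addmC.
have e i : ((j == i) + (k == i) = (a == i) + (b == i))%N.
  have /mnmP/(_ (rshift 6 i)) := E.
  by rewrite (mnmDE _ (eta j)) (mnmDE _ (eta a)) !eta_y.
have := e j; have := e k; rewrite !xpair_eqE !eqxx.
have [->|aj] := eqVneq a j.
  by rewrite [b == k]eq_sym => /addnI; case: (k == b) => // _ _; left.
have [->|bj _] := eqVneq b j; last by case: (k == j).
by rewrite [a == k]eq_sym addnC => /addIn; case: (k == a) => // _ _; right.
Qed.

(** The monomial of the product of the [x_k] with [P k]. *)
Definition xmon (P : pred 'I_6) : 'X_{1..6 + 6} :=
  (\sum_(k < 6 | P k) U_(lshift 6 k))%MM.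

Lemma xmonE P : 'X_[xmon P] = \prod_(k < 6 | P k) xvar k.
Proof. by rewrite /xmon -mprodXE. Qed.

Lemma etaE j : 'X_[eta j] = yvar j * \prod_(k < 6 | k != j) xvar k.
Proof. by rewrite /eta mpolyXD -xmonE. Qed.

(** The product of two of the monomials [eta j], [eta k] is divisible by that of
    the [x_i] with [i != m], unless it is a square with [j != m]. *)
Lemma xmon_le_eta m j k : ~~ ((j == k) && (j != m)) ->
  (xmon (predC1 m) <= eta j + eta k)%MM.
Proof.
move=> jk; apply/mnm_lepP => i; case: (split_ordP i) => l ->.
  rewrite (mnmDE _ (eta j)) !eta_x /xmon mnm_sumE.
  under eq_bigr do rewrite mnm1E eq_lshift.
  have [->|lm] := eqVneq l m; first by rewrite big1 // => s /negPf ->.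
  rewrite (bigD1 l) //= eqxx big1 => [|s /andP[_ /negPf ->] //].
  have [lj|//] := eqVneq l j; have [lk|//] := eqVneq l k.
  by rewrite -lj -lk eqxx lm in jk.
by rewrite /xmon mnm_sumE big1 // => s _; rewrite mnm1E eq_lrshift.
Qed.

Lemma lpolyE r : tnth (lpoly A) r = \sum_j A r j *: 'X_[eta j].
Proof. by rewrite tnth_mktuple; apply: eq_bigr => j _; rewrite etaE. Qed.

Lemma linear_form (g : {mpoly K[3]}) : g \is 1.-homog ->
  exists v : 'rV[K]_3, g = \sum_r v 0 r *: 'X_r.
Proof.
move=> /dhomogP g1; rewrite [g]mpolyE big_seq.
pose lin (p : {mpoly K[3]}) := exists v : 'rV[K]_3, p = \sum_r v 0 r *: 'X_r.
apply: (big_ind lin) => [|_ _ [v ->] [w ->]|m mg].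
- by exists 0; rewrite big1 // => r _; rewrite mxE scale0r.
- by exists (v + w); rewrite -big_split; apply: eq_bigr => r _; rewrite mxE scalerDl.
have /eqP/mdeg1P[r /eqP->] := g1 m mg.
exists (g@_U_(r) *: delta_mx 0 r); rewrite (bigD1 r) //= big1 => [|s sr].
  by rewrite !mxE !eqxx mulr1 addr0.
by rewrite !mxE (negPf sr) mulr0 scale0r.
Qed.

Lemma mdeg2P (m : 'X_{1..3}) : mdeg m = 2%N ->
  exists r s, m = (U_(r) + U_(s))%MM.
Proof.
move=> m2; have [r mr] : exists r, m r != 0%N.
  apply/existsP; rewrite -[[exists _, _]]negbK negb_exists; apply/negP => /forallP m0.
  have /eqP := m2; rewrite mdegE big1 // => r _.
  by have := m0 r; rewrite negbK => /eqP.
have rm : (U_(r) <= m)%MM by rewrite lep1mP.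
have /eqP : mdeg (m - U_(r))%MM = 1%N 
  by apply: (@addIn 1); have := mdegD (m - U_(r)) U_(r); rewrite submK // m2 mdeg1.
by case/mdeg1P => s /eqP E; exists s, r; rewrite -E submK.
Qed.

Lemma quadratic_form (g : {mpoly K[3]}) : (2%:R : K) != 0 -> g \is 2.-homog ->
  exists2 Q : 'M[K]_3, Q^T = Q & g = \sum_r \sum_s Q r s *: ('X_r * 'X_s).
Proof.
move=> two0 /dhomogP g2; rewrite [g]mpolyE big_seq.
pose quad (p : {mpoly K[3]}) := exists2 Q : 'M[K]_3,
  Q^T = Q & p = \sum_r \sum_s Q r s *: ('X_r * 'X_s).
apply: (big_ind quad) => [|_ _ [P sP ->] [Q sQ ->]|m mg].
- exists 0; first by rewrite trmx0.
  by rewrite big1 // => r _; rewrite big1 // => s _; rewrite mxE scale0r.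
- exists (P + Q); first by rewrite linearD /= sP sQ.
  rewrite -big_split; apply: eq_bigr => r _; rewrite -big_split.
  by apply: eq_bigr => s _; rewrite mxE scalerDl.
have [a [b ->]] := mdeg2P (g2 m mg).
have sumE (c d : 'I_3) :
    \sum_r \sum_s (delta_mx c d : 'M[K]_3) r s *: ('X_r * 'X_s)
    = 'X_[U_(c) + U_(d)] :> {mpoly K[3]}.
  rewrite (bigD1 c isT) (bigD1 d isT) /= mxE !eqxx scale1r mpolyXD.
  rewrite big1 => [|s /negPf sd]; last by rewrite mxE sd andbF scale0r.
  rewrite addr0 big1 ?addr0 // => r /negPf rc.
  by rewrite big1 // => s _; rewrite mxE rc scale0r.
pose c := g@_(U_(a) + U_(b)) / 2%:R.
exists (c *: (delta_mx a b + delta_mx b a)).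
  by rewrite linearZ linearD /= !trmx_delta addrC.
have -> : g@_(U_(a) + U_(b)) = c + c by rewrite /c; field.
transitivity (c *: ('X_[U_(a) + U_(b)] + 'X_[U_(b) + U_(a)] : {mpoly K[3]})).
  by rewrite [(U_(b) + _)%MM]addmC scalerDr scalerDl.
rewrite -!sumE -big_split scaler_sumr; apply: eq_bigr => r _.
rewrite -big_split scaler_sumr; apply: eq_bigr => s _.
by rewrite /= -scalerDl scalerA !mxE.
Qed.

Lemma linear_vanishes (v : 'rV[K]_3) i :
  vanishes_at A (\sum_r v 0 r *: 'X_r) i <-> (v *m A) 0 i = 0.
Proof.
rewrite /vanishes_at raddf_sum /= mxE.
by under eq_bigr do rewrite mevalZ mevalXU.
Qed.

Lemma linear_comp (v : 'rV[K]_3) :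
  (\sum_r v 0 r *: 'X_r) \mPo lpoly A = \sum_u (v *m A) 0 u *: 'X_[eta u].
Proof.
rewrite raddf_sum /=.
under eq_bigr do rewrite comp_mpolyZ comp_mpolyXU -tnth_nth lpolyE scaler_sumr.
rewrite exchange_big; apply: eq_bigr => u _ /=.
by under eq_bigr do rewrite scalerA; rewrite -scaler_suml mxE.
Qed.

Lemma quadratic_value (Q : 'M[K]_3) i j :
  (A^T *m Q *m A) i j = \sum_r \sum_s Q r s * (A r i * A s j).
Proof.
rewrite mxE exchange_big; apply: eq_bigr => s _; rewrite mxE mulr_suml.
by apply: eq_bigr => r _; rewrite mxE; ring.
Qed.

Lemma quadratic_vanishes (Q : 'M[K]_3) i :
  vanishes_at A (\sum_r \sum_s Q r s *: ('X_r * 'X_s)) i <->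
  (A^T *m Q *m A) i i = 0.
Proof.
rewrite /vanishes_at raddf_sum quadratic_value /=.
under eq_bigr do rewrite raddf_sum /=.
by under eq_bigr => r _ do under eq_bigr do rewrite mevalZ mevalM !mevalXU.
Qed.

Lemma quadratic_comp (Q : 'M[K]_3) :
  (\sum_r \sum_s Q r s *: ('X_r * 'X_s)) \mPo lpoly A =
  \sum_(p : 'I_6 * 'I_6) (A^T *m Q *m A) p.1 p.2 *: 'X_[eta p.1 + eta p.2].
Proof.
transitivity (\sum_r \sum_s \sum_j \sum_k
    (Q r s * (A r j * A s k)) *: ('X_[eta j + eta k] : {mpoly K[6 + 6]})).
  rewrite raddf_sum; apply: eq_bigr => r _ /=; rewrite raddf_sum.
  apply: eq_bigr => s _ /=; rewrite comp_mpolyZ rmorphM /= !comp_mpolyXU.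
  rewrite -!tnth_nth !lpolyE mulr_suml scaler_sumr; apply: eq_bigr => j _.
  rewrite mulr_sumr scaler_sumr; apply: eq_bigr => k _.
  by rewrite -scalerAl -scalerAr !scalerA mpolyXD mulrA.
under eq_bigr => r _ do under eq_bigr do rewrite pair_bigA /=.
rewrite pair_bigA exchange_big; apply: eq_bigr => p _ /=.
by rewrite quadratic_value pair_bigA scaler_suml.
Qed.

End Generators.

(** * Coefficients of the generators *)

Lemma K2_neq0 : (2%:R : K) != 0.
Proof. by rewrite -(rmorph_nat (@tofrac _)) tofrac_eq0 -polyC_natr polyC_eq0. Qed.

(** For [k < 5], the index of rank [k] among the five indices other than [m]. *)
Definition other (m : 'I_6) (k : nat) : 'I_6 := lift m (@inZp 4 k).

(** The polar form of the conic through the five points other than [m]. *)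
Definition mpolar (A : 'M[K]_(3, 6)) (m : 'I_6) : 'I_6 -> 'I_6 -> K :=
  bpolar A (other m 0) (other m 1) (other m 2) (other m 3) (other m 4).

(** No three of the six points lie on a line. *)
Definition in_general_position (A : 'M[K]_(3, 6)) :=
  forall i j k, uniq [:: i; j; k] -> bracket A i j k != 0.

Section Values.
Variable A : 'M[K]_(3, 6).
Hypothesis gpA : in_general_position A.

(** The generator of a line, times a monomial: its coefficients are proportional
    to the brackets [[i j u]]. *)
Lemma line_generator (i j : 'I_6) (g : {mpoly K[3]}) f :
  (i < j)%N -> g != 0 -> g \is 1.-homog ->
  vanishes_at A g i -> vanishes_at A g j ->
  f * xvar i * xvar j = g \mPo lpoly A ->
  exists2 c, c != 0 & f * 'X_[U_(lshift 6 i) + U_(lshift 6 j)] =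
    \sum_u (c * bracket A i j u) *: 'X_[eta u].
Proof.
move=> ij g0 /linear_form[v gE]; rewrite gE in g0 *.
rewrite !linear_vanishes linear_comp => vi vj fE.
have [k kij] : exists k : 'I_6, k \notin [:: i; j].
  apply/existsP; rewrite -[[exists _, _]]negbK negb_exists.
  apply/negP => /forallP all_in.
  have sub : {subset enum 'I_6 <= [:: i; j]}.
    by move=> k _; have := all_in k; rewrite negbK.
  by have := uniq_leq_size (enum_uniq _) sub; rewrite size_enum_ord.
have b0 : bracket A i j k != 0.
  apply: gpA; rewrite -[[:: i; j; k]]/([:: i; j] ++ [:: k]) uniq_catC /= kij.
  by rewrite inE andbT -val_eqE /= ltn_eqF.
have v0 : v != 0.
  by apply: contraNneq g0 => ->; rewrite big1 // => r _; rewrite mxE scale0r.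
have [c c0 cE] := line_values b0 v0 vi vj.
exists c => //; rewrite mpolyXD mulrA fE.
by apply: eq_bigr => u _; rewrite cE.
Qed.

(** The same for the conic through the five points other than [m]. *)
Lemma conic_generator (m : 'I_6) (q : {mpoly K[3]}) f :
  q != 0 -> q \is 2.-homog ->
  (forall j : 'I_6, j != m -> vanishes_at A q j) ->
  f * \prod_(j < 6 | j != m) xvar j = q \mPo lpoly A ->
  exists2 c, c != 0 & f * 'X_[xmon (predC1 m)] =
    \sum_(p : 'I_6 * 'I_6) (c * mpolar A m p.1 p.2) *: 'X_[eta p.1 + eta p.2].
Proof.
move=> q0 /(quadratic_form K2_neq0)[Q sQ qE]; rewrite qE in q0 *.
move=> qv; rewrite quadratic_comp => fE.
have van k : (A^T *m Q *m A) (other m k) (other m k) = 0.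
  by apply/quadratic_vanishes/qv; rewrite eq_sym neq_lift.
have Q0 : Q != 0.
  apply: contraNneq q0 => ->; rewrite big1 // => r _.
  by rewrite big1 // => s _; rewrite mxE scale0r.
have gp a b c : uniq [:: (@inZp 4 a); inZp b; inZp c] ->
    bracket A (other m a) (other m b) (other m c) != 0.
  move=> abc; apply: gpA.
  by rewrite -(map_inj_uniq (@lift_inj _ m)) in abc.
have [c c0 cE] := @conic_values _ _ A Q K2_neq0 sQ (other m 0) (other m 1)
  (other m 2) (other m 3) (other m 4) (gp 0 1 2 isT) (gp 2 3 4 isT)
  (gp 3 2 0 isT) (gp 4 2 0 isT) (gp 3 0 1 isT) (gp 4 0 1 isT) Q0
  (van 0) (van 1) (van 2) (van 3) (van 4).
exists c => //; rewrite xmonE fE; apply: eq_bigr => p _.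
by rewrite cE.
Qed.
End Values.

Section ConicExists.
Variable A : 'M[K]_(3, 6).

(** The linear form [u |-> [b c u]]. *)
Definition line_form (b c : 'I_6) : 'rV[K]_3 := \row_r
  [fun r => 0 with r0 |-> A r1 b * A r2 c - A r1 c * A r2 b,
     r1 |-> A r2 b * A r0 c - A r2 c * A r0 b,
     r2 |-> A r0 b * A r1 c - A r0 c * A r1 b] r.

Lemma line_formE b c u : (line_form b c *m A) 0 u = bracket A b c u.
Proof. by rewrite mxE sum3 !mxE /= /bracket /det3; ring. Qed.

(** The product of two lines through [a], as a symmetric matrix: the line through
    [a] and [c], and the line through [a] and [b]. *)
Definition conic_term (k : K) (a b c : 'I_6) : 'M[K]_3 :=
  k *: ((line_form c a)^T *m line_form a b + (line_form a b)^T *m line_form c a).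

(** The value at the columns [u], [v] of the bilinear form of matrix [Q]. *)
Definition form (Q : 'M[K]_3) (u v : 'I_6) : K := (A^T *m Q *m A) u v.

Lemma formD P Q u v : form (P + Q) u v = form P u v + form Q u v.
Proof.
rewrite /form mulmxDr mulmxDl; move: (_ *m A) (_ *m A) => X Y.
by rewrite mxE.
Qed.

Lemma formZ k P u v : form (k *: P) u v = k * form P u v.
Proof.
by rewrite /form -scalemxAr -scalemxAl; move: (_ *m A) => X; rewrite mxE.
Qed.

Lemma form_mul (x y : 'rV[K]_3) u v :
  form (x^T *m y) u v = (x *m A) 0 u * (y *m A) 0 v.
Proof.
rewrite /form -!mulmxA mulmxA -trmx_mul; move: (_ *m A) (_ *m A) => X Y.
by rewrite mxE big_ord1 mxE.
Qed.

Lemma conic_termE k a b c u v : form (conic_term k a b c) u v =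
  k * (bracket A a u c * bracket A a b v + bracket A a v c * bracket A a b u).
Proof.
have cyc w : bracket A a w c = bracket A c a w by rewrite /bracket /det3; ring.
rewrite /conic_term formZ formD !form_mul !line_formE.
by rewrite -!cyc [bracket A a b u * _]mulrC.
Qed.

(** The matrix of the conic through [a], [b], [c], [d], [e]. *)
Definition conic_matrix (a b c d e : 'I_6) : 'M[K]_3 :=
  let k a b c := bracket A d b c * bracket A e b c * bracket A a d e in
  conic_term (k a b c) a b c
  + (conic_term (k b c a) b c a + conic_term (k c a b) c a b).

Lemma conic_matrixE a b c d e u v :
  form (conic_matrix a b c d e) u v = bpolar A a b c d e u v.
Proof.
by rewrite /conic_matrix formD formD; congr (_ + (_ + _)); apply: conic_termE.
Qed.

(** Conversely, the conic through the five points other than [m] gives a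
    generator with these coefficients. *)
Lemma conic_generator_exists m : (forall j, j != m -> mpolar A m j j = 0) ->
  mpolar A m m m != 0 ->
  exists2 f, cox_generator A f & f * 'X_[xmon (predC1 m)] =
    \sum_(p : 'I_6 * 'I_6) mpolar A m p.1 p.2 *: 'X_[eta p.1 + eta p.2].
Proof.
move=> diag0 mm0.
pose Q := conic_matrix (other m 0) (other m 1) (other m 2) (other m 3) (other m 4).
have QE u v : form Q u v = mpolar A m u v by apply: conic_matrixE.
pose q : {mpoly K[3]} := \sum_r \sum_s Q r s *: ('X_r * 'X_s).
pose f : {mpoly K[6 + 6]} := \sum_(p : 'I_6 * 'I_6)
  mpolar A m p.1 p.2 *: 'X_[eta p.1 + eta p.2 - xmon (predC1 m)].
have fE : f * 'X_[xmon (predC1 m)] =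
    \sum_(p : 'I_6 * 'I_6) mpolar A m p.1 p.2 *: 'X_[eta p.1 + eta p.2].
  rewrite mulr_suml; apply: eq_bigr => -[u v] _ /=; rewrite -scalerAl -mpolyXD.
  have [/andP[/eqP <- um]|uv] := boolP ((u == v) && (u != m)).
    by rewrite diag0 // !scale0r.
  by rewrite submK // xmon_le_eta.
exists f => //; apply: (@CoxConic _ m q).
- apply: contraNneq mm0 => q0; rewrite -QE /form; apply/eqP/quadratic_vanishes.
  by rewrite -/q q0 /vanishes_at meval0.
- rewrite /q; apply: rpred_sum => r _; apply: rpred_sum => s _.
  by apply: rpredZ; rewrite -mpolyXD dhomogX /= mdegD !mdeg1.
- by move=> j jm; apply/quadratic_vanishes; rewrite -/(form _ _ _) QE diag0.
by rewrite quadratic_comp -xmonE fE; apply: eq_bigr => p _; rewrite -QE.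
Qed.
End ConicExists.

(** * The subspace determines the brackets up to a common scalar *)

Lemma mem_ker_space (A : 'M[K]_(3, 6)) (v : 'cV[K]_6) :
  (v \in ker_space A) = (A *m v == 0).
Proof. by rewrite memv_ker lfunE. Qed.

Lemma ker_space_mul (A B : 'M[K]_(3, 6)) : ker_space A = ker_space B ->
  exists U : 'M[K]_3, A = U *m B.
Proof.
move=> AB; suff /submxP[U ->] : (A <= B)%MS by exists U.
rewrite submxE; apply/eqP/matrixP => r s.
have : col s (cokermx B) \in ker_space A.
  by rewrite AB mem_ker_space colE mulmxA mulmx_coker mul0mx.
rewrite mem_ker_space colE mulmxA -colE => /eqP/colP/(_ r).
by rewrite mxE => ->; rewrite !mxE.
Qed.

Lemma bracket_ker (A B : 'M[K]_(3, 6)) : ker_space A = ker_space B ->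
  in_general_position B ->
  exists2 c, c != 0 & forall i j k, bracket A i j k = c * bracket B i j k.
Proof.
move=> AB gpB; have [U AE] := ker_space_mul AB.
have [V BE] := ker_space_mul (esym AB).
exists (\det U); last by move=> i j k; rewrite AE bracket_mul.
have b0 : bracket B (inZp 0) (inZp 1) (inZp 2) != 0 by apply: gpB.
by apply: contraNneq b0 => U0; rewrite BE bracket_mul AE bracket_mul U0 mul0r mulr0.
Qed.

Lemma general_position_ker (A B : 'M[K]_(3, 6)) : ker_space A = ker_space B ->
  in_general_position B -> in_general_position A.
Proof.
move=> AB gpB i j k ijk; have [c c0 cE] := bracket_ker AB gpB.
by rewrite cE; exact: mulf_neq0 c0 (gpB _ _ _ ijk).
Qed.

Lemma dim_ker_space (A : 'M[K]_(3, 6)) : in_general_position A ->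
  \dim (ker_space A) = 3%N.
Proof.
move=> gpA; have := limg_ker_dim (linfun (mulmx A : 'cV[K]_6 -> 'cV[K]_3)) fullv.
rewrite capfv dimvf /dim /= muln1.
suff -> : limg (linfun (mulmx A : 'cV[K]_6 -> 'cV[K]_3)) = fullv.
  by rewrite dimvf /dim /= muln1 -[6%N]/(3 + 3)%N => /addIn.
apply/vspaceP => w; rewrite memvf; apply/memv_imgP.
have : row_free A.
  rewrite -kermx_eq0; apply/eqP.
  have b0 : bracket A (inZp 0) (inZp 1) (inZp 2) != 0 by apply: gpA.
  by apply: (bracket_row_free b0); rewrite mulmx_ker.
case/row_freeP => B AB1; exists (B *m w); first exact: memvf.
by rewrite lfunE /= mulmxA AB1 mul1mx.
Qed.

Lemma pluckerE (A : 'M[K]_(3, 6)) s :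
  plucker A s = bracket A (tnth s r0) (tnth s r1) (tnth s r2).
Proof. by rewrite /plucker det_mx3 /det3 !mxE. Qed.

(** The expression [C] for the columns of [A]. *)
Definition conic_bracket (A : 'M[K]_(3, 6)) : K :=
  conic6 +%R *%R -%R (bracket A) (inZp 0) (inZp 1) (inZp 2) (inZp 3) (inZp 4) (inZp 5).

Lemma conic_condE (A : 'M[K]_(3, 6)) : conic_cond A = conic_bracket A.
Proof. by rewrite /conic_cond /p1 !pluckerE. Qed.

Lemma conic6_scale (S : comNzRingType) (I : Type) (c : S) (br br' : I -> I -> I -> S)
    i1 i2 i3 i4 i5 i6 : (forall i j k, br i j k = c * br' i j k) ->
  conic6 +%R *%R -%R br i1 i2 i3 i4 i5 i6
  = c ^+ 4 * conic6 +%R *%R -%R br' i1 i2 i3 i4 i5 i6.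
Proof. by move=> brE; rewrite /conic6 !brE; ring. Qed.

Lemma polar_scale (S : comNzRingType) (I : Type) (s : S) (br br' : I -> I -> I -> S)
    a b c d e u v : (forall i j k, br i j k = s * br' i j k) ->
  polar +%R *%R br a b c d e u v = s ^+ 5 * polar +%R *%R br' a b c d e u v.
Proof. by move=> brE; rewrite /polar /polar_term !brE; ring. Qed.

Lemma conic_cond_scale (A B : 'M[K]_(3, 6)) c :
  (forall i j k, bracket A i j k = c * bracket B i j k) ->
  conic_cond A = c ^+ 4 * conic_cond B.
Proof.
by move=> AB; rewrite !conic_condE; apply: conic6_scale.
Qed.

Lemma triple_uniq (s : triple) :
  uniq [:: tnth (\val s) r0; tnth (\val s) r1; tnth (\val s) r2].
Proof.
case: s => s /= srt.
have : sorted ltn [seq nat_of_ord i | i <- [:: tnth s r0; tnth s r1; tnth s r2]].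
  by move: srt; case: s => -[|i [|j [|k []]]].
by move/(sorted_uniq ltn_trans ltnn); rewrite map_inj_uniq //; exact: val_inj.
Qed.

(** * Equality of the points of the two parametrizing sets *)

Section Phi.
Variable R : realType.
Variables A B : 'M[K]_(3, 6).
Hypothesis gpA : in_general_position A.
Hypothesis eq_val :
  forall s : triple, val (plucker A (\val s)) = val (plucker B (\val s)).

Lemma plucker_neq0 (M : 'M[K]_(3, 6)) (s : triple) : in_general_position M ->
  plucker M (\val s) != 0.
Proof. by move=> gpM; rewrite pluckerE; apply: gpM; apply: triple_uniq. Qed.

(** Scaling the brackets of [A] translates the tropical Plücker vector, which is
    that of [B], by a constant. *)
Lemma trop_plucker_ker (A' : 'M[K]_(3, 6)) c : c != 0 ->
  (forall i j k, bracket A' i j k = c * bracket A i j k) ->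
  trop_plucker R A' = trop_plucker R B + [ffun => - (val c)%:~R].
Proof.
move=> c0 cE; apply/ffunP => s; rewrite !ffunE -opprD; congr (- _).
have -> : plucker A' (\val s) = c * plucker A (\val s) by rewrite !pluckerE cE.
have p0 := plucker_neq0 s gpA.
by rewrite (val_mul c0 p0) eq_val addrC intrD.
Qed.

Lemma Phi_Gr_sub w : Phi_Gr (R := R) (ker_space A) w -> Phi_Gr (ker_space B) w.
Proof.
case=> A' kA' [a wE]; have [c c0 cE] := bracket_ker kA' gpA.
exists B; [exact: erefl|exists (a - (val c)%:~R)]; apply/ffunP => s.
have /ffunP/(_ s) := wE; rewrite (trop_plucker_ker c0 cE) !ffunE.
by move: (val c)%:~R (val _)%:~R => x y <-; ring.
Qed.

Lemma Phi_Nar_sub w : conic_cond A != 0 ->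
  val (conic_cond A) = val (conic_cond B) ->
  Phi_Nar (R := R) (ker_space A) w -> Phi_Nar (ker_space B) w.
Proof.
move=> C0 CE [A' kA' [mu wE]]; have [c c0 cE] := bracket_ker kA' gpA.
have cA' : val (conic_cond A') = val c + val c + val c + val c + val (conic_cond B).
  rewrite (conic_cond_scale cE) (val_mul (expf_neq0 4 c0) C0) (val_exp 4 c0).
  by rewrite CE !mulrS mulr0n addr0 !addrA.
exists B; [exact: erefl|
  (* A constant [a] is the image of [mu = a / 3]; its last coordinate is [4 a]. *)
  exists (fun i => mu i - (val c)%:~R / 3%:R)].
move: wE; rewrite /trop_plucker_conic (trop_plucker_ker c0 cE) cA'.
move: (val c) (val (conic_cond B)) => vc vC; rewrite !intrD.
move: vc%:~R vC%:~R => x y.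
case: w => w1 w2 [/ffunP w1E w2E]; congr pair.
  apply/ffunP => s; have := w1E s; rewrite !ffunE !sum3.
  move: (val _)%:~R => z E; apply: (addIr x).
  transitivity (mu (tnth (\val s) r0) + mu (tnth (\val s) r1) + mu (tnth (\val s) r2)).
    by rewrite -E; ring.
  by field.
by rewrite sumrB mulrBr -w2E sumr_const card_ord -mulr_natr /=; field.
Qed.
End Phi.

(** * Polynomials as lists of integer coefficients *)

(** The polynomial with the given coefficients, constant term first. *)
Definition polyL (s : seq int) : {poly rat} :=
  foldr (fun a p => p * 'X + (a%:~R)%:P) 0 s.

(** The ring operations on lists of coefficients. *)
Fixpoint addL (s s' : seq int) : seq int :=
  match s, s' with
  | [::], _ => s'
  | _, [::] => s
  | a :: r, b :: r' => (a + b) :: addL r r'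
  end.

Definition oppL (s : seq int) : seq int := [seq - a | a <- s].

Definition mulL (s s' : seq int) : seq int :=
  foldr (fun a p => addL [seq a * b | b <- s'] (0 :: p)) [::] s.

Lemma polyLD : {morph polyL : s s' / addL s s' >-> s + s'}.
Proof.
elim=> [|a s IH] [|b s'] /=; rewrite ?add0r ?addr0 //.
by rewrite IH intrD polyCD; ring.
Qed.

Lemma polyLN : {morph polyL : s / oppL s >-> - s}.
Proof.
elim=> [|a s IH] /=; first by rewrite oppr0.
by rewrite IH rmorphN polyCN /=; ring.
Qed.

Lemma polyL_scale a s : polyL [seq a * b | b <- s] = (a%:~R)%:P * polyL s.
Proof.
by elim: s => [|b s IH] /=; rewrite ?mulr0 // IH intrM polyCM; ring.
Qed.

Lemma polyLM : {morph polyL : s s' / mulL s s' >-> s * s'}.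
Proof.
move=> s s'; elim: s => [|a s IH] /=; first by rewrite mul0r.
by rewrite polyLD polyL_scale /= IH polyC0; ring.
Qed.

Lemma polyL_drop d s : all (pred1 0) (take d s) ->
  polyL s = 'X^d * polyL (drop d s).
Proof.
elim: d s => [|d IH] [|a s] //=; rewrite ?expr0 ?mul1r ?mulr0 //.
by case/andP => /eqP -> /IH ->; rewrite polyC0 exprS; ring.
Qed.

Lemma polyL_head d s : (polyL (drop d s)).[0] = (nth 0 s d)%:~R.
Proof.
elim: d s => [|d IH] [|a s] //=; rewrite ?horner0 //.
by rewrite hornerD hornerMX mulr0 hornerC add0r.
Qed.

(** The order of vanishing at 0 of a nonzero polynomial. *)
Definition orderL (s : seq int) : nat := find (predC1 0) s.

(** Some coefficient is nonzero; trailing zeros are allowed in the lists. *)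
Definition nonzeroL (s : seq int) : bool := has (predC1 0) s.

Lemma polyL_order s : nonzeroL s ->
  exists2 r : {poly rat}, r.[0] != 0 & polyL s = 'X^(orderL s) * r.
Proof.
move=> s0; exists (polyL (drop (orderL s) s)).
  by rewrite polyL_head intr_eq0; exact: (nth_find 0 s0).
apply: polyL_drop; apply/(all_nthP 0) => i; rewrite size_take_min leq_min => /andP[i_d _].
by rewrite nth_take //; have /negbFE := before_find 0 i_d.
Qed.

Lemma polyL_neq0 s : nonzeroL s -> polyL s != 0.
Proof.
case/polyL_order => r r0 ->; rewrite mulf_eq0 expf_eq0 polyX_eq0 andbF /=.
by apply: contraNneq r0 => ->; rewrite horner0.
Qed.

Lemma polyL_eq0 s : ~~ nonzeroL s -> polyL s = 0.
Proof.
elim: s => //= a s IH; rewrite /nonzeroL /= negb_or negbK => /andP[/eqP-> /IH ->].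
by rewrite mul0r polyC0 addr0.
Qed.

Definition fracL (s : seq int) : K := (polyL s)%:F.

Lemma val_fracL s : nonzeroL s -> val (fracL s) = (orderL s)%:Z.
Proof.
move=> s0; rewrite /fracL valF ?polyL_neq0 //.
have [r r0 ->] := polyL_order s0; rewrite mup_XnM ?mup_eq0 ?addn0 //.
by apply: contraNneq r0 => ->; rewrite horner0.
Qed.

Lemma fracLD : {morph fracL : s s' / addL s s' >-> s + s'}.
Proof. by move=> s s'; rewrite /fracL polyLD rmorphD. Qed.
Lemma fracLM : {morph fracL : s s' / mulL s s' >-> s * s'}.
Proof. by move=> s s'; rewrite /fracL polyLM rmorphM. Qed.
Lemma fracLN : {morph fracL : s / oppL s >-> - s}.
Proof. by move=> s; rewrite /fracL polyLN rmorphN. Qed.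

Section Matrices.
Variable M : nat -> nat -> seq int.

(** The matrix whose entries are the polynomials [M r j]. *)
Definition matL : 'M[K]_(3, 6) := \matrix_(r, j) fracL (M r j).

(** The brackets of [matL], computed on lists. *)
Definition bracketL : nat -> nat -> nat -> seq int :=
  det3 addL mulL oppL (M 0) (M 1) (M 2).

Lemma bracketLE (i j k : 'I_6) : bracket matL i j k = fracL (bracketL i j k).
Proof.
rewrite /bracketL (det3_morph fracLD fracLM fracLN (@nat_of_ord 6)).
by rewrite /bracket /det3 !mxE.
Qed.

(** The polar forms [mpolar] of [matL], computed on lists. *)
Definition mpolarL (m : nat) : nat -> nat -> seq int :=
  polar addL mulL bracketL (bump m 0) (bump m 1) (bump m 2) (bump m 3) (bump m 4).

Lemma mpolarLE (m u v : 'I_6) : mpolar matL m u v = fracL (mpolarL m u v).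
Proof.
symmetry; rewrite /mpolar /bpolar.
rewrite -(polar_morph fracLD fracLM (h := @nat_of_ord 6) (br := bracketL)) //.
by move=> i j k; rewrite bracketLE.
Qed.

(** The expression [C] for [matL], computed on lists. *)
Definition conicL : seq int := conic6 addL mulL oppL bracketL 0 1 2 3 4 5.

Lemma conicLE : conic_cond matL = fracL conicL.
Proof.
symmetry; rewrite conic_condE /conic_bracket.
rewrite -(conic6_morph fracLD fracLM fracLN (h := @nat_of_ord 6) (br := bracketL)) //.
by move=> i j k; rewrite bracketLE.
Qed.

(** All the polynomials [L x] with [x] in [idx] vanish to order at least [d], and
    [D] contains exactly those [x] in [idx] for which the order is [d]. *)
Definition initial_set (T : eqType) (idx : seq T) (L : T -> seq int) (d : nat)
    (D : seq T) : bool :=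
  all (fun x => all (pred1 0) (take d (L x)) &&
                ((nth 0 (L x) d != 0) == (x \in D))) idx.

(** All brackets of three distinct columns are nonzero. *)
Definition general_positionL : bool :=
  all (fun i => all (fun j => all (fun k =>
    uniq [:: i; j; k] ==> nonzeroL (bracketL i j k))
  (iota 0 6)) (iota 0 6)) (iota 0 6).

(** For each line, the lowest order of the coefficients is attained once. *)
Definition lineL_moneric : bool :=
  all (fun i => all (fun j => (i < j)%N ==>
    has (fun d => has (fun u => initial_set (iota 0 6) (bracketL i j) d [:: u])
      (iota 0 6)) (iota 0 10))
  (iota 0 6)) (iota 0 6).

(** The indices of the coefficients of the conics. *)
Definition pairs : seq (nat * nat) := [seq (u, v) | u <- iota 0 6, v <- iota 0 6].

(** For the conic that omits the point [m], the lowest order is [d], attained at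
    the pairs in [D]. *)
Definition conicL_initial (m : nat) : nat -> seq (nat * nat) -> bool :=
  initial_set pairs (fun p => mpolarL m p.1 p.2).

(** For each [m], the entry [(d, (u, v))] of [w] gives the lowest order [d], which
    is attained only at [(u, v)] and at [(v, u)], with the same coefficient. *)
Definition conicL_moneric (w : seq (nat * (nat * nat))) : bool :=
  all (fun m => let: (d, (u, v)) := nth (0, (0, 0)) w m in
    [&& (u < 6)%N, (v < 6)%N, conicL_initial m d [:: (u, v); (v, u)]
      & nth 0 (mpolarL m u v) d == nth 0 (mpolarL m v u) d])
  (iota 0 6).

End Matrices.

(** * Monericity from the coefficients *)

(** [moneric_sum] and [not_moneric_sum] for coefficients given as lists. *)
Section SumL.
Variables (I : finType) (n : nat) (mu : I -> 'X_{1..n}) (L : I -> seq int).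
Variables (c : K) (d : nat).
Hypotheses (c0 : c != 0) (L0 : forall i, all (pred1 0) (take d (L i))).
Let f : {mpoly K[n]} := \sum_i (c * fracL (L i)) *: 'X_[mu i].
Let lead (m : 'X_{1..n}) : int := \sum_(i | mu i == m) nth 0 (L i) d.
Let r i := polyL (drop d (L i)).

Let fE : f = \sum_i (c * ('X^d * r i)%:F) *: 'X_[mu i].
Proof. by apply: eq_bigr => i _; rewrite /fracL (polyL_drop (L0 i)). Qed.

Let leadE m : \sum_(i | mu i == m) (r i).[0] = (lead m)%:~R :> rat.
Proof. by rewrite rmorph_sum; apply: eq_bigr => i _; exact: polyL_head. Qed.

Lemma moneric_sumL m0 : lead m0 != 0 ->
  (forall i, mu i != m0 -> nth 0 (L i) d = 0) -> moneric_poly f.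
Proof.
move=> lm0 L0'; rewrite fE; apply: (@moneric_sum _ _ mu r c d c0 m0).
  by rewrite leadE intr_eq0.
by move=> i /L0' E; rewrite /r polyL_head E.
Qed.

Lemma not_moneric_sumL m0 m1 : m0 != m1 -> lead m0 != 0 -> lead m1 != 0 ->
  ~ moneric_poly f.
Proof.
move=> m01 lm0 lm1; rewrite fE; apply: (@not_moneric_sum _ _ mu r c d c0 m0 m1) => //.
  by rewrite leadE intr_eq0.
by rewrite leadE intr_eq0.
Qed.
End SumL.

Lemma ord_iota n (i : 'I_n) : (i : nat) \in iota 0 n.
Proof. by rewrite mem_iota ltn_ord. Qed.

(** The sum over the pairs [p] with [eta p.1 + eta p.2] a given monomial has
    one term, or two terms that differ by the order of the pair. *)
Lemma sum_eta_pair (w : 'I_6 * 'I_6 -> int) u v : w (u, v) = w (v, u) ->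
  w (u, v) != 0 ->
  \sum_(p | (eta p.1 + eta p.2 == eta u + eta v)%MM) w p != 0.
Proof.
move=> w_sym w0; rewrite (eq_bigl (pred2 (u, v) (v, u))) => [|[j k]]; last exact: etaD_eq.
have [uv|uv] := eqVneq u v.
  rewrite uv in w_sym w0 *; rewrite (big_pred1 (v, v)) // => p /=.
  by rewrite orbb.
rewrite (bigD1 (u, v)) /= ?eqxx // (big_pred1 (v, u)) => [|p /=].
  by rewrite -w_sym -mulr2n mulrn_eq0.
have [->|] := eqVneq p (u, v); last by rewrite andbT.
by rewrite andbF xpair_eqE (negPf uv).
Qed.

Section Moneric.
Variable M : nat -> nat -> seq int.
Hypothesis gpM : general_positionL M.

Lemma general_position_matL : in_general_position (matL M).
Proof.
move=> i j k ijk; rewrite bracketLE.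
have /allP/(_ _ (ord_iota i))/allP/(_ _ (ord_iota j))/allP/(_ _ (ord_iota k)) := gpM.
move: ijk; rewrite -(map_inj_uniq (@ord_inj 6)) => ijk.
rewrite ijk => b0; rewrite /fracL tofrac_eq0; exact: polyL_neq0.
Qed.

Lemma moneric_matL w : lineL_moneric M -> conicL_moneric M w ->
  moneric (ker_space (matL M)).
Proof.
move=> linesM conicsM A f' kA.
have gpA := general_position_ker kA general_position_matL.
have [s s0 sE] := bracket_ker kA general_position_matL.
case=> [i c c0|i j g f ij g0 g1 vi vj fE|m q f q0 q2 vq fE].
- have := @moneric_sumL _ _ (fun=> U_(lshift 6 i)%MM) (fun _ : 'I_1 => [:: 1]) c 0 c0.
  rewrite big_ord1.
  have -> : fracL [:: 1] = 1 by rewrite /fracL /polyL /= mul0r add0r polyC1 tofrac1.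
  rewrite mulr1 => /(_ (fun=> isT) U_(lshift 6 i)%MM); apply=> [|k].
    by rewrite eqxx big_ord1.
  by rewrite eqxx.
- have [c c0 {}fE] := line_generator gpA ij g0 g1 vi vj fE.
  apply/(moneric_poly_mulX f (U_(lshift 6 i) + U_(lshift 6 j))).
  rewrite fE; under eq_bigr do rewrite sE bracketLE mulrA.
  have /allP/(_ _ (ord_iota i))/allP/(_ _ (ord_iota j)) := linesM.
  rewrite ij => /hasP[d _ /hasP[u u_iota /allP allini]].
  have lt_u : (u < 6)%N by move: u_iota; rewrite mem_iota.
  have ini (k : 'I_6) := allini _ (ord_iota k).
  have ns (k : 'I_6) : (nth 0 (bracketL M i j k) d != 0) = (k == Ordinal lt_u).
    by have /andP[_ /eqP->] := ini k; rewrite inE.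
  apply: (@moneric_sumL _ _ eta (fun k : 'I_6 => bracketL M i j k) _ d
            (mulf_neq0 c0 s0) _ (eta (Ordinal lt_u))) => [k||k].
  + by have /andP[] := ini k.
  + rewrite (big_pred1 (Ordinal lt_u)) => [|k]; last exact: (inj_eq eta_inj).
    by rewrite ns.
  by rewrite (inj_eq eta_inj) -ns negbK => /eqP.
have [c c0 {}fE] := conic_generator gpA q0 q2 vq fE.
apply/(moneric_poly_mulX f (xmon (predC1 m))).
have mE p : c * mpolar A m p.1 p.2 = c * s ^+ 5 * fracL (mpolarL M m p.1 p.2).
  by rewrite -mulrA -mpolarLE; congr (c * _); apply: polar_scale.
rewrite fE; under eq_bigr do rewrite mE.
have /allP/(_ _ (ord_iota m)) := conicsM.
case: (nth _ w m) => d [u v] /and4P[lt_u lt_v].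
rewrite /conicL_initial /initial_set => /allP allini /eqP Lsym.
have mem_pair (p : 'I_6 * 'I_6) : (p.1 : nat, p.2 : nat) \in pairs.
  by apply: allpairs_f; exact: ord_iota.
have ini (p : 'I_6 * 'I_6) := allini _ (mem_pair p).
pose u6 := Ordinal lt_u; pose v6 := Ordinal lt_v.
pose m0 := (eta u6 + eta v6)%MM.
have ns (p : 'I_6 * 'I_6) : (nth 0 (mpolarL M m p.1 p.2) d != 0) =
    (eta p.1 + eta p.2 == m0)%MM.
  have /andP[_ /eqP->] := ini p; rewrite !inE etaD_eq.
  by case: p.
apply: (@moneric_sumL _ _ (fun p : 'I_6 * 'I_6 => (eta p.1 + eta p.2)%MM)
          (fun p => mpolarL M m p.1 p.2) _ d (mulf_neq0 c0 (expf_neq0 5 s0)) _ m0).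
- by move=> p; have /andP[] := ini p.
- have w0 := ns (u6, v6); rewrite eqxx in w0.
  exact: (@sum_eta_pair (fun p => nth 0 (mpolarL M m p.1 p.2) d) u6 v6 Lsym w0).
by move=> p; rewrite -ns negbK => /eqP.
Qed.

(** It is enough that for one conic the lowest order is attained at two pairs with
    different monomials. *)
Lemma not_moneric_matL (m : 'I_6) d (u v u' v' : 'I_6) D :
  all (fun j : nat => (j == m) (+) ~~ nonzeroL (mpolarL M m j j)) (iota 0 6) ->
  conicL_initial M m d D ->
  nth 0 (mpolarL M m u v) d = nth 0 (mpolarL M m v u) d ->
  nth 0 (mpolarL M m u' v') d = nth 0 (mpolarL M m v' u') d ->
  (u : nat, v : nat) \in D -> (u' : nat, v' : nat) \in D ->
  (eta u + eta v != eta u' + eta v')%MM ->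
  ~ moneric (ker_space (matL M)).
Proof.
move=> /allP diag; rewrite /conicL_initial /initial_set => /allP allini.
move=> Lsym Lsym' uvD uvD' neq /(_ (matL M)).
have [|| f f_gen fE] := @conic_generator_exists (matL M) m.
- move=> j jm; have := diag j (ord_iota j).
  rewrite (inj_eq (@ord_inj 6)) (negPf jm) mpolarLE /fracL => /polyL_eq0 ->.
  by rewrite tofrac0.
- have := diag m (ord_iota m); rewrite eqxx /= negbK mpolarLE /fracL tofrac_eq0.
  exact: polyL_neq0.
move=> /(_ f erefl f_gen)/(moneric_poly_mulX f (xmon (predC1 m))).
rewrite fE; under eq_bigr do rewrite mpolarLE -[fracL _]mul1r.
have mem_pair (p : 'I_6 * 'I_6) : (p.1 : nat, p.2 : nat) \in pairs.
  by apply: allpairs_f; exact: ord_iota.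
pose w (p : 'I_6 * 'I_6) := nth 0 (mpolarL M m p.1 p.2) d.
have ns (p : 'I_6 * 'I_6) : (p.1 : nat, p.2 : nat) \in D -> w p != 0.
  by move=> pD; have /andP[_ /eqP->] := allini _ (mem_pair p).
apply: (@not_moneric_sumL _ _ (fun p : 'I_6 * 'I_6 => (eta p.1 + eta p.2)%MM)
          (fun p => mpolarL M m p.1 p.2) 1 d (oner_neq0 _) _ _ _ neq).
- by move=> p; have /andP[] := allini _ (mem_pair p).
- exact: (@sum_eta_pair w u v Lsym (ns (u, v) uvD)).
- exact: (@sum_eta_pair w u' v' Lsym' (ns (u', v') uvD')).
Qed.
End Moneric.

(** * The two subspaces *)

(** The list of coefficients of [c t^k]. *)
Definition mono (c : int) (k : nat) : seq int := rcons (nseq k 0) c.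

(** The matrix
    [t  0    0   t^2   t^3  1  ]
    [0  t^2  0  -t^3   t^2  1  ]
    [0  0    1  -t^4   t^4  t^3]. *)
Definition M1 (r j : nat) : seq int := nth [::] (nth [::]
  [:: [:: mono 1 1; [::]; [::]; mono 1 2; mono 1 3; mono 1 0];
      [:: [::]; mono 1 2; [::]; mono (-1) 3; mono 1 2; mono 1 0];
      [:: [::]; [::]; mono 1 0; mono (-1) 4; mono 1 4; mono 1 3]] r) j.

(** The matrix
    [t  0    0   t^2   t^3  1  ]
    [0  t^2  0  -t^3  -t^2  1  ]
    [0  0    1   t^4   t^4  t^3]. *)
Definition M2 (r j : nat) : seq int := nth [::] (nth [::]
  [:: [:: mono 1 1; [::]; [::]; mono 1 2; mono 1 3; mono 1 0];
      [:: [::]; mono 1 2; [::]; mono (-1) 3; mono (-1) 2; mono 1 0];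
      [:: [::]; [::]; mono 1 0; mono 1 4; mono 1 4; mono 1 3]] r) j.

Lemma M1_general : general_positionL M1.
Proof. by vm_compute. Qed.

Lemma M2_general : general_positionL M2.
Proof. by vm_compute. Qed.

Lemma admissible_matL M : general_positionL M -> nonzeroL (conicL M) ->
  admissible (ker_space (matL M)).
Proof.
move=> gpM C0; have gp := general_position_matL gpM.
split; first exact: dim_ker_space.
exists (matL M); split; first by [].
  by move=> s; apply: plucker_neq0.
by rewrite conicLE /fracL tofrac_eq0; apply: polyL_neq0.
Qed.

Lemma M1_admissible : admissible (ker_space (matL M1)).
Proof. by apply: admissible_matL M1_general _; vm_compute. Qed.

Lemma M2_admissible : admissible (ker_space (matL M2)).
Proof. by apply: admissible_matL M2_general _; vm_compute. Qed.

Lemma M1_moneric : moneric (ker_space (matL M1)).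
Proof.
(* The lowest order and the pair of indices, counted from 0, of the initial
   monomial of each of the six conics. *)
by apply: (moneric_matL M1_general (w := [:: (18, (2, 5)); (16, (2, 5));
  (25, (2, 2)); (15, (2, 5)); (15, (2, 5)); (20, (2, 5))])); vm_compute.
Qed.

Lemma M2_not_moneric : ~ moneric (ker_space (matL M2)).
Proof.
(* The monomials [Y_1 Y_3] and [Y_6^2] of the conic through the first five
   points. *)
apply: (@not_moneric_matL M2 (inZp 5) 21 (inZp 0) (inZp 2) (inZp 5) (inZp 5)
          [:: (0, 2); (2, 0); (5, 5)]).
- by vm_compute.
- by vm_compute.
- by vm_compute.
- by vm_compute.
- by [].
- by [].
- by rewrite etaD_eq.
Qed.

(** The brackets of the two matrices vanish to the same orders. *)
Definition same_orders (M N : nat -> nat -> seq int) : bool :=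
  all (fun i => all (fun j => all (fun k => uniq [:: i; j; k] ==>
    (orderL (bracketL M i j k) == orderL (bracketL N i j k)))
  (iota 0 6)) (iota 0 6)) (iota 0 6).

Lemma same_val M N : general_positionL M -> general_positionL N ->
  same_orders M N ->
  forall s : triple, val (plucker (matL M) (\val s)) = val (plucker (matL N) (\val s)).
Proof.
move=> gpM gpN MN s; have := triple_uniq s; rewrite !pluckerE !bracketLE.
move: (tnth _ r0) (tnth _ r1) (tnth _ r2) => i j k.
rewrite -(map_inj_uniq (@ord_inj 6)) => ijk.
have nz P : general_positionL P -> nonzeroL (bracketL P i j k).
  move=> /allP/(_ _ (ord_iota i))/allP/(_ _ (ord_iota j))/allP/(_ _ (ord_iota k)).
  by rewrite ijk.
rewrite !val_fracL ?nz //.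
have /allP/(_ _ (ord_iota i))/allP/(_ _ (ord_iota j))/allP/(_ _ (ord_iota k)) := MN.
by rewrite ijk => /eqP ->.
Qed.

Lemma M12_val (s : triple) :
  val (plucker (matL M1) (\val s)) = val (plucker (matL M2) (\val s)).
Proof. by apply: (same_val M1_general M2_general); vm_compute. Qed.

(** Both conic conditions are [t^18 - t^20]. *)
Lemma M12_conic_val : val (conic_cond (matL M1)) = val (conic_cond (matL M2)).
Proof. by rewrite !conicLE !val_fracL. Qed.

Lemma Phi_Gr_M12 (R : realType) :
  Phi_Gr (R := R) (ker_space (matL M1)) = Phi_Gr (ker_space (matL M2)).
Proof.
have gp1 := general_position_matL M1_general.
have gp2 := general_position_matL M2_general.
apply: boolp.funext => w; apply: boolp.propext; split.
  exact: (Phi_Gr_sub gp1 M12_val).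
by apply: (Phi_Gr_sub gp2) => s; rewrite M12_val.
Qed.

Lemma Phi_Nar_M12 (R : realType) :
  Phi_Nar (R := R) (ker_space (matL M1)) = Phi_Nar (ker_space (matL M2)).
Proof.
have gp1 := general_position_matL M1_general.
have gp2 := general_position_matL M2_general.
have C0 M : nonzeroL (conicL M) -> conic_cond (matL M) != 0.
  by move=> C0; rewrite conicLE /fracL tofrac_eq0; apply: polyL_neq0.
have C1 : conic_cond (matL M1) != 0 by apply: C0; vm_compute.
have C2 : conic_cond (matL M2) != 0 by apply: C0; vm_compute.
apply: boolp.funext => w; apply: boolp.propext; split.
  exact: (Phi_Nar_sub gp1 M12_val C1 M12_conic_val).
have M21_val s := esym (M12_val s).
exact: (Phi_Nar_sub gp2 M21_val C2 (esym M12_conic_val)).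
Qed.

Theorem proposition6p4 (R : realType) :
  (~ good_parametrizing (@Phi_Gr R) /\ ~ good_parametrizing (@Phi_Nar R)) /\
  (exists G G' : {vspace 'cV[K]_6},
     [/\ admissible G /\ admissible G', Phi_Gr (R := R) G = Phi_Gr G',
         moneric G & ~ moneric G']) /\
  (exists G G' : {vspace 'cV[K]_6},
     [/\ admissible G /\ admissible G', Phi_Nar (R := R) G = Phi_Nar G',
         moneric G & ~ moneric G']).
Proof.
have adm := conj M1_admissible M2_admissible.
split; [split => good; apply: M2_not_moneric | split].
- exact: good M1_admissible M2_admissible (Phi_Gr_M12 R) M1_moneric.
- exact: good M1_admissible M2_admissible (Phi_Nar_M12 R) M1_moneric.
- by exists (ker_space (matL M1)), (ker_space (matL M2)); split;
    [exact: adm | exact: Phi_Gr_M12 | exact: M1_moneric | exact: M2_not_moneric].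
- by exists (ker_space (matL M1)), (ker_space (matL M2)); split;
    [exact: adm | exact: Phi_Nar_M12 | exact: M1_moneric | exact: M2_not_moneric].
Qed.
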